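(* Let $0<a,b<1/2$ be such that $\log b/\log a$ is irrational, and let $\lambda\neq 0$ be real. Then the measure $\nu_{a,b}^\lambda=\mu_a*(\mu_b\circ S_\lambda^{-1})$ satisfies \[ D(\nu_{a,b}^\lambda)=\dim_H(\nu_{a,b}^\lambda)=\dim_P(\nu_{a,b}^\lambda)=\min(\dim_H(C_a)+\dim_H(C_b),1) \] (in particular the correlation dimension $D(\nu_{a,b}^\lambda)$ exists).
   Context: For $0<a<1/2$, $C_a=\left\{(1-a)\sum_{j=0}^\infty \omega_j a^j:\ \omega_j\in\{0,1\}\text{ for all }j\right\}$ is the central Cantor set. $\mu_a$ is the distribution of the random sum $(1-a)\sum_{j=0}^\infty\omega_j a^j$, where the $\omega_j$ are independent with $\mathbf{P}(\omega_j=0)=\mathbf{P}(\omega_j=1)=1/2$. For $\lambda\in\mathbb{R}$, $S_\lambda(x)=\lambda x$; $\mu_b\circ S_\lambda^{-1}$ is the push-forward of $\mu_b$ under $S_\lambda$, and $*$ is convolution of measures on $\mathbb{R}$. For a Borel measure $\nu$ on $\mathbb{R}^n$ and $r>0$, let $\mathcal{C}_\nu(r)=\int \nu(B(x,r))\,d\nu(x)$, where $B(x,r)$ is the closed ball of center $x$ and radius $r$. The correlation dimension of $\nu$ is $D(\nu)=\lim_{r\downarrow 0}\frac{\log\mathcal{C}_\nu(r)}{\log r}$, when the limit exists. The Hausdorff and packing dimensions of a finite Borel measure $\nu$ on $\mathbb{R}^n$ are $\dim_H(\nu)=\inf\{\dim_H(E):\nu(\mathbb{R}^n\setminus E)=0\}$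 and $\dim_P(\nu)=\inf\{\dim_P(E):\nu(\mathbb{R}^n\setminus E)=0\}$, where for sets $\dim_H$ and $\dim_P$ denote Hausdorff and packing dimension. *)

(* Defs.v *)
From HB Require Import structures.
From mathcomp Require Import all_boot all_order all_algebra finmap.
From mathcomp Require Import all_classical all_reals all_analysis measurable_realfun.

Set Implicit Arguments.
Unset Strict Implicit.
Unset Printing Implicit Defensive.

Import Order.TTheory GRing.Theory Num.Theory.
Import numFieldNormedType.Exports.

Local Open Scope classical_set_scope.
Local Open Scope ring_scope.

Section HausdorffDimension.
Context {R : realType}.
Local Open Scope ereal_scope.

Definition diameter (U : set R) : \bar R :=
  ereal_sup (0 |` [set `|z.1 - z.2|%:E | z in U `*` U]).

(* [0 `^ 0 = 1] in the library, so that a nonempty set of diameter 0 has weight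
   1 for s = 0; the empty set has weight 0 for every s. *)
Definition diam_pow (s : R) (U : set R) : \bar R :=
  if U == set0 then 0 else diameter U `^ s.

Definition hausdorff_premeasure (s delta : R) (E : set R) : \bar R :=
  ereal_inf [set \sum_(0 <= i <oo) diam_pow s (U i) | U in
    [set U : (set R)^nat |
      E `<=` \bigcup_i U i /\ forall i, diameter (U i) <= delta%:E]].

Definition hausdorff_measure (s : R) (E : set R) : \bar R :=
  ereal_sup [set hausdorff_premeasure s delta E |
             delta in [set delta : R | (0 < delta)%R]].

Definition hausdorff_dim (E : set R) : \bar R :=
  ereal_inf [set s%:E | s in [set s : R |
    (0 <= s)%R /\ hausdorff_measure s E = 0]].

End HausdorffDimension.

Section PackingDimension.
Context {R : realType}.
Local Open Scope ereal_scope.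

(* A delta-packing of E: countably many disjoint closed balls, centered in E and
   of radius at most delta, the balls being indexed by a set D of naturals. *)
Definition packing (delta : R) (E : set R) (D : set nat) (x r : nat -> R) :=
  (forall i, D i -> E (x i) /\ (0 < r i <= delta)%R) /\
  trivIset D (fun i => closed_ball (x i) (r i)).

Definition packing_value (s : R) (D : set nat) (r : nat -> R) : \bar R :=
  \esum_(i in D) ((2 * r i) `^ s)%:E.

Definition packing_premeasure_at (s delta : R) (E : set R) : \bar R :=
  ereal_sup [set v | exists D x r,
    packing delta E D x r /\ v = packing_value s D r].

Definition packing_premeasure (s : R) (E : set R) : \bar R :=
  ereal_inf [set packing_premeasure_at s delta E |
             delta in [set delta : R | (0 < delta)%R]].

Definition packing_measure (s : R) (E : set R) : \bar R :=
  ereal_inf [set \sum_(0 <= i <oo) packing_premeasure s (F i) | F in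
    [set F : (set R)^nat | E `<=` \bigcup_i F i]].

Definition packing_dim (E : set R) : \bar R :=
  ereal_inf [set s%:E | s in [set s : R |
    (0 <= s)%R /\ packing_measure s E = 0]].

End PackingDimension.

Section MeasureDimensions.
Context {R : realType}.
Variable nu : {measure set R -> \bar R}.

(* [E] ranges over Borel sets: [nu] is a Borel measure, and its value on a
   non-measurable set carries no meaning. *)
Definition measure_hausdorff_dim : \bar R :=
  ereal_inf [set hausdorff_dim E | E in
    [set E : set R | measurable E /\ nu (~` E) = 0%E]].

Definition measure_packing_dim : \bar R :=
  ereal_inf [set packing_dim E | E in
    [set E : set R | measurable E /\ nu (~` E) = 0%E]].

Definition correlation_integral (r : R) : \bar R :=
  (\int[nu]_x nu (closed_ball x r))%E.

(* [fine] is harmless when [nu] is finite, the integral being then finite. *)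
Definition correlation_quotient (r : R) : R :=
  ln (fine (correlation_integral r)) / ln r.

(* Meaningful only when the limit exists, i.e. when
   [cvg (correlation_quotient r @[r --> 0^'+])]. *)
Definition correlation_dim : R := lim (correlation_quotient r @[r --> 0^'+]).

End MeasureDimensions.

Section ConvolutionScaling.
Context {R : realType}.

Definition add_pair (z : R * R) : R := z.1 + z.2.

Lemma measurable_add_pair : measurable_fun [set: R * R] add_pair.
Proof. by apply: measurable_funD; [exact: measurable_fst|exact: measurable_snd]. Qed.

HB.instance Definition _ :=
  isMeasurableFun.Build _ _ _ _ add_pair measurable_add_pair.

Definition convolution (mu nu : probability R R) : probability R R :=
  distribution (mu \x nu)%E add_pair.

Definition scaling (lambda x : R) : R := lambda * x.

Lemma measurable_scaling (lambda : R) : measurable_fun [set: R] (scaling lambda).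
Proof. exact: mulrl_measurable. Qed.

HB.instance Definition _ (lambda : R) :=
  isMeasurableFun.Build _ _ _ _ (scaling lambda) (measurable_scaling lambda).

Definition scaled (lambda : R) (mu : probability R R) : probability R R :=
  distribution mu (scaling lambda).

End ConvolutionScaling.

Section FairCoins.
Context {R : realType} {d : measure_display} {Om : measurableType d}.
Variable P : probability Om R.

Definition mutually_independent {d' : measure_display} {T : measurableType d'}
    {I : choiceType} (X : I -> {RV P >-> T}) : Prop :=
  forall (J : {fset I}) (B : I -> set T), (forall i, measurable (B i)) ->
    P (\bigcap_(i in [set` J]) (X i @^-1` B i)) =
    \big[*%E/1%E]_(i <- J) P (X i @^-1` B i).

(* The coin omega_j takes the value 0 when [omega j] is false, 1 otherwise. *)
Definition fair_coins (omega : nat -> {RV P >-> bool}) : Prop :=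
  mutually_independent omega /\
  forall j, P [set t | omega j t = false] = (2^-1)%:E /\
            P [set t | omega j t = true] = (2^-1)%:E.

End FairCoins.

Arguments fair_coins {R d Om} P omega.

Section CentralCantor.
Context {R : realType}.

Definition cantor_sum (a : R) (w : nat -> bool) : R :=
  (1 - a) * limn (series (fun j => (w j)%:R * a ^+ j)).

Definition cantor_set (a : R) : set R := range (cantor_sum a).

Context {d : measure_display} {Om : measurableType d}.
Variable P : probability Om R.

Definition random_cantor_sum (a : R) (_ : 0 < a < 2^-1)
    (omega : nat -> {RV P >-> bool}) (t : Om) : R :=
  cantor_sum a (fun j => omega j t).

Lemma measurable_random_cantor_sum (a : R) (ha : 0 < a < 2^-1)
    (omega : nat -> {RV P >-> bool}) :
  measurable_fun [set: Om] (random_cantor_sum ha omega).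
Proof.
have [a0 a12] := andP ha.
have a1 : `|a| < 1.
  by rewrite gtr0_norm// (lt_trans a12)// invf_lt1// ltr1n.
have mnat : measurable_fun [set: bool] (fun b : bool => b%:R : R) by [].
apply: measurable_funM => //.
apply: (@measurable_fun_cvg _ _ _ _
  (fun n t => \sum_(0 <= j < n) (omega j t)%:R * a ^+ j)) => [n|t _].
  apply: measurable_sum => j; apply: measurable_funM => //.
  exact: (measurableT_comp mnat).
have : cvgn (series (geometric 1 a)) by exact: is_cvg_geometric_series.
apply: series_le_cvg => n /=; rewrite ?mul1r.
- by rewrite mulr_ge0// exprn_ge0// ltW.
- by rewrite exprn_ge0// ltW.
- by apply: ler_piMl; [rewrite exprn_ge0// ltW|case: (omega n t)].
Qed.

HB.instance Definition _ (a : R) (ha : 0 < a < 2^-1)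
    (omega : nat -> {RV P >-> bool}) :=
  isMeasurableFun.Build _ _ _ _ (random_cantor_sum ha omega)
    (measurable_random_cantor_sum ha omega).

(* For fair coins [omega], this law depends on [a] only: the same [omega] can be
   used for several values of [a], and [convolution], which goes through the
   product measure, is that of the laws. *)
Definition cantor_measure (a : R) (ha : 0 < a < 2^-1)
    (omega : nat -> {RV P >-> bool}) : probability R R :=
  distribution P (random_cantor_sum ha omega).

End CentralCantor.

Arguments cantor_measure {R d Om} P {a} ha omega.

(* Main.v *)
From HB Require Import structures.
Require Import Defs.
From mathcomp Require Import all_boot all_order all_algebra finmap.
From mathcomp Require Import all_classical all_reals all_analysis measurable_realfun.
From mathcomp Require Import lra ring zify.

Set Implicit Arguments.
Unset Strict Implicit.
Unset Printing Implicit Defensive.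

Import Order.TTheory GRing.Theory Num.Theory.
Import numFieldNormedType.Exports.

Local Open Scope classical_set_scope.
Local Open Scope ring_scope.

(** Dimension is governed by the collision sums [pcoll a b lambda n m r], the
    proportion of pairs of points x_u + lambda y_v, with u and v words of [n] and
    [m] binary digits, that are within [r] of each other.  Self-similarity makes
    the sums at the scales a^n submultiplicative along the orbit of [lambda]:
    after [L] more digits in base a (and as many in base b as match this
    precision), the relative scale of the two factors moves by a rotation of
    angle L ln a / ln b modulo 1.  So the sum at the scale a^(kL) is bounded by
    a product over k points of an orbit of this rotation.  By the AM-GM
    inequality it suffices to bound the mean of the factors, which, for each pair
    of points, is a frequency of visits of the orbit to an arc; irrationality
    bounds it by a multiple of the length of the arc (transversality), and
    summing over the pairs gives a^(L D) up to a factor linear in [L], where D is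
    the expected dimension.  Letting [L] grow yields the correlation dimension.
    Correlation bounds give lower bounds of the Hausdorff and packing dimensions
    by the mass distribution principle, while the attractor C_a + lambda C_b
    provides the upper bounds. *)

(** * Averages over finite families *)

Section Averages.
Context {R : realType}.

(** For one given relative scale, many pairs of words may give nearly equal points, so no single
    factor of the product can be bounded well. What can be bounded, for a fixed pair, is the set of
    relative scales that bring its two points close: it lies in a short interval. Hence the average
    over scales, taken along the rotation. The order of the choices matters. Visits to an arc are
    bounded uniformly in its position, with an additive error that depends on its length only. For
    fixed [L] finitely many lengths, proportional to a^L / b^i, occur, so the total error is a
    constant that disappears after division by k. A step costs a constant factor independent of [L],
    and the mean a factor linear in [L]; there is one step for every [L] digits, so a^(-eL) absorbs
    both once [L] is large. The linear factor counts the scales b^i at which the two base b words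
    may first differ: each contributes at most a multiple of a^(LD), whether D is 1 or the sum of
    the two dimensions. *)

Definition avg (I : Type) (s : seq I) (F : I -> R) : R :=
  (\sum_(i <- s) F i) / (size s)%:R.

Lemma le_avg (I : eqType) (s : seq I) (F G : I -> R) :
  (forall i, i \in s -> F i <= G i) -> avg s F <= avg s G.
Proof.
move=> FG; rewrite ler_wpM2r ?invr_ge0 ?ler0n//.
by rewrite !big_seq; exact: ler_sum.
Qed.

Lemma eq_avg (I : eqType) (s : seq I) (F G : I -> R) :
  (forall i, i \in s -> F i = G i) -> avg s F = avg s G.
Proof. by move=> FG; rewrite /avg; congr (_ / _); exact: eq_big_seq. Qed.

Lemma avg_ge0 (I : eqType) (s : seq I) (F : I -> R) :
  (forall i, i \in s -> 0 <= F i) -> 0 <= avg s F.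
Proof.
by move=> F0; rewrite divr_ge0 ?ler0n// big_seq sumr_ge0.
Qed.

Lemma avgD (I : Type) (s : seq I) (F G : I -> R) :
  avg s (fun i => F i + G i) = avg s F + avg s G.
Proof. by rewrite /avg big_split mulrDl. Qed.

Lemma avgZr (I : Type) (s : seq I) (c : R) (F : I -> R) :
  avg s (fun i => F i * c) = avg s F * c.
Proof. by rewrite /avg -mulr_suml mulrAC. Qed.

Lemma avg_cst (I : Type) (s : seq I) (c : R) :
  (0 < size s)%N -> avg s (fun=> c) = c.
Proof.
move=> s0;
  rewrite /avg big_const_seq count_predT iter_addr_0 -[c *+ _]mulr_natr.
by rewrite mulfK// pnatr_eq0 -lt0n.
Qed.

Lemma avg_sum (I J : Type) (s : seq I) (t : seq J) (F : I -> J -> R) :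
  avg s (fun i => \sum_(j <- t) F i j) = \sum_(j <- t) avg s (F^~ j).
Proof. by rewrite /avg exchange_big /= mulr_suml. Qed.

Lemma exchange_avg (I J : Type) (s : seq I) (t : seq J) (F : I -> J -> R) :
  avg s (fun i => avg t (F i)) = avg t (fun j => avg s (F^~ j)).
Proof.
by rewrite /avg -!mulr_suml exchange_big /= mulrAC.
Qed.

Lemma avg_allpairs (I J : Type) (s : seq I) (t : seq J) (F : I * J -> R) :
  avg [seq (i, j) | i <- s, j <- t] F =
  avg s (fun i => avg t (fun j => F (i, j))).
Proof.
rewrite /avg size_allpairs natrM invfM big_allpairs -!mulr_suml.
by rewrite mulrA mulrAC.
Qed.

(** Pairs with [g i = h j] are counted value by value as the sum over [k] of [c g k * c h k], and a
    product is at most half the sum of the squares. *)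
Lemma avg_eq_le (I K : eqType) (s : seq I) (g h : I -> K) :
  avg s (fun i => avg s (fun j => (g i == h j)%:R)) <=
  (avg s (fun i => avg s (fun j => (g i == g j)%:R)) +
   avg s (fun i => avg s (fun j => (h i == h j)%:R))) / 2.
Proof.
pose S := undup (map g s ++ map h s).
pose c (f : I -> K) k : R := \sum_(i <- s) (f i == k)%:R.
have E f f' : {subset map f s <= S} ->
    avg s (fun i => avg s (fun j => (f i == f' j)%:R)) =
    (\sum_(k <- S) c f k * c f' k) / (size s)%:R ^+ 2.
  move=> fS; rewrite /avg -mulr_suml -mulrA -invfM -expr2; congr (_ / _).
  under [RHS]eq_bigr do rewrite /c big_distrlr /=.
  rewrite [RHS]exchange_big /=; apply: eq_big_seq => i si.
  rewrite [RHS]exchange_big /=; apply: eq_bigr => j _.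
  have fiS : f i \in S by apply: fS; exact: map_f.
  rewrite (bigD1_seq (f i)) ?undup_uniq//= eqxx mul1r big1 ?addr0 1?eq_sym//.
  by move=> k /negPf kfi; rewrite eq_sym kfi mul0r.
have gS : {subset map g s <= S} by move=> k; rewrite mem_undup mem_cat => ->.
have hS : {subset map h s <= S}.
  by move=> k; rewrite mem_undup mem_cat => ->; rewrite orbT.
rewrite !E// -mulrDl mulrAC ler_wpM2r ?invr_ge0 ?exprn_ge0 ?ler0n//.
rewrite -big_split mulr_suml; apply: ler_sum => k _ /=.
by have := sqr_ge0 (c g k - c h k); nra.
Qed.

Definition coll (I : Type) (s : seq I) (f : I -> R) (r : R) : R :=
  avg s (fun i => avg s (fun j => (`|f i - f j| <= r)%R%:R)).

(* Pairs at distance at most [T * r] of [z] fall in cells of two grids of mesh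
   [r], shifted by [z], whose indices differ by at most [T]. *)
Lemma avg_shift_le (I : eqType) (s : seq I) (f : I -> R) (T : nat) (z r : R) :
  0 < r ->
  avg s (fun i => avg s (fun j => (`|f i - f j - z| <= T%:R * r)%R%:R)) <=
  (2 * T + 1)%:R * coll s f r.
Proof.
move=> r0.
pose g i := Num.floor (f i / r).
(* As [d] runs from 0 to [2 * T], the offset [d - T] takes every possible difference of the two cell
   indices. *)
pose h (d : nat) j := Num.floor ((f j + z) / r) + (d%:Z - T%:Z).
have cell (F : I -> R) (e : int) i j :
    (forall i j, F i - F j = f i - f j) ->
    ((Num.floor (F i / r) + e == Num.floor (F j / r) + e)%:R : R) <=
    (`|f i - f j| <= r)%R%:R.
  move=> Ff; case: eqVneq => [|_]; last by rewrite ler0n.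
  move/addIr => ij; rewrite -Ff.
  suff -> : `|F i - F j| <= r by [].
  have /andP[i1 i2] := floor_itv (F i / r).
  have /andP[] := floor_itv (F j / r); rewrite -ij => j1 j2.
  rewrite intrD in i2 j2.
  move: i1 i2 j1 j2; rewrite !ler_pdivlMr// !ltr_pdivrMr//.
  rewrite ler_norml; set x := _%:~R => *; nra.
have key i j : ((`|f i - f j - z| <= T%:R * r)%R%:R : R) <=
    \sum_(0 <= d < 2 * T + 1) (g i == h d j)%:R.
  case: (boolP (_ <= T%:R * r)) => [le|_]; last first.
    by rewrite mulr0n; apply: sumr_ge0 => d _; rewrite ler0n.
  have /andP[i1 i2] := floor_itv (f i / r).
  have /andP[j1 j2] := floor_itv ((f j + z) / r).
  pose e := g i - Num.floor ((f j + z) / r).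
  have eT : - T%:Z <= e <= T%:Z.
    have [lo hi] : - T%:R - 1 < e%:~R :> R /\ e%:~R < T%:R + 1 :> R.
      rewrite intrB; move: i1 i2 j1 j2; rewrite !intrD.
      rewrite !ler_pdivlMr// !ltr_pdivrMr// -/(g i).
      set x := (g i)%:~R; set y := _%:~R.
      move: le; rewrite ler_norml => /andP[] *; split.
        by rewrite -(ltr_pM2r r0); nra.
      by rewrite -(ltr_pM2r r0); nra.
    move: lo hi; rewrite -[T%:R]/((T%:Z)%:~R) -[1]/(1%:~R) -intrN -intrB -intrD.
    rewrite !ltr_int; lia.
  have d1 : (absz (e + T%:Z)%R < 2 * T + 1)%N by lia.
  rewrite (bigD1_seq (absz (e + T%:Z)%R)) ?iota_uniq ?mem_index_iota//=.
  have -> : g i == h (absz (e + T%:Z)%R) j by rewrite /h; apply/eqP; lia.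
  by rewrite lerDl sumr_ge0.
apply: (@le_trans _ _ (\sum_(0 <= d < 2 * T + 1)
    avg s (fun i => avg s (fun j => (g i == h d j)%:R)))).
  rewrite -avg_sum; apply: le_avg => i _.
  by rewrite -avg_sum; apply: le_avg => j _.
rewrite mulr_natl -[X in _ *+ X]subn0 -sumr_const_nat; apply: ler_sum => d _.
apply: (le_trans (avg_eq_le _ _ _)).
rewrite ler_pdivrMr// mulr_natr mulr2n lerD//;
  apply: le_avg => i _; apply: le_avg => j _.
- by rewrite /g -(inj_eq (addIr 0)); exact: cell.
- by apply: (cell (fun j => f j + z)) => ? ?; rewrite opprD addrACA subrr addr0.
Qed.

(** Bounded factors in the radius thus cost bounded factors in the collision sum, and constants in
    the radii are harmless for dimensions. *)
Lemma coll_scale_le (I : eqType) (s : seq I) (f : I -> R) (T : nat) (r : R) :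
  0 < r -> coll s f (T%:R * r) <= (2 * T + 1)%:R * coll s f r.
Proof.
move=> r0; apply: le_trans (avg_shift_le _ _ _ 0 r0).
by apply: le_avg => i _; apply: le_avg => j _; rewrite subr0.
Qed.

Lemma coll_ge0 (I : eqType) (s : seq I) (f : I -> R) r : 0 <= coll s f r.
Proof. by apply: avg_ge0 => i _; apply: avg_ge0 => j _; rewrite ler0n. Qed.

Lemma le_coll (I : eqType) (s : seq I) (f g : I -> R) (r r' : R) :
  (forall i j, i \in s -> j \in s ->
     `|f i - f j| <= r -> `|g i - g j| <= r') ->
  coll s f r <= coll s g r'.
Proof.
move=> fg; apply: le_avg => i si; apply: le_avg => j sj.
by case: (boolP (_ <= r)) => [/fg ->//|_]; rewrite ler0n.
Qed.

End Averages.

(** * Words and collision sums *)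

Fixpoint words (n : nat) : seq (seq bool) :=
  if n is n'.+1 then map (cons false) (words n') ++ map (cons true) (words n')
  else [:: [::]].

Lemma size_words n : size (words n) = (2 ^ n)%N.
Proof. by elim: n => //= n IH; rewrite size_cat !size_map IH expnS; lia. Qed.

Lemma mem_words n w : (w \in words n) = (size w == n).
Proof.
elim: n w => [|n IH] [|e w] //=; rewrite mem_cat.
  by apply/negbTE/norP; split; apply/mapP => -[].
rewrite eqSS -IH; apply/orP/idP.
  by case=> /mapP[v vn [_ ->]].
by case: e => wn; [right|left]; exact: map_f.
Qed.

Lemma words_uniq n : uniq (words n).
Proof.
elim: n => //= n IH; rewrite cat_uniq !map_inj_uniq ?IH /=; try
  by move=> ? ? [].
by rewrite andbT; apply/hasPn => _ /mapP[v _ ->]; apply/mapP => -[].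
Qed.

(** For words of equal length, the length of the longest common prefix; equal words give their full
    length. *)
Fixpoint fdiff (v w : seq bool) : nat :=
  match v, w with
  | b :: v', c :: w' => if b == c then (fdiff v' w').+1 else 0
  | _, _ => 0
  end.

Section Words.
Context {R : realType}.
Implicit Types (a b lambda r : R) (u v w : seq bool).

Lemma avg_words0 (F : seq bool -> R) : avg (words 0) F = F [::].
Proof. by rewrite /avg big_seq1 divr1. Qed.

Lemma avg_wordsS n (F : seq bool -> R) :
  avg (words n.+1) F =
  (avg (words n) (F \o cons false) + avg (words n) (F \o cons true)) / 2.
Proof.
rewrite /avg !size_words big_cat !big_map /= -mulrDl -mulrA expnS natrM.
by rewrite invfM [2^-1 * _]mulrC.
Qed.

Lemma avg_words_cat n n' (F : seq bool -> R) :
  avg (words (n + n')) F =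
  avg (words n) (fun u => avg (words n') (fun v => F (u ++ v))).
Proof.
elim: n F => [|n IH] F; first by rewrite avg_words0.
by rewrite addSn !avg_wordsS !IH.
Qed.

Lemma avg_words_cst n (c : R) : avg (words n) (fun=> c) = c.
Proof. by rewrite avg_cst// size_words expn_gt0. Qed.

(* [(1 - a) * \sum_j w_j a^j], by Horner's rule. *)
Fixpoint cval a w : R :=
  if w is e :: w' then (1 - a) * e%:R + a * cval a w' else 0.

Lemma cval_itv a w : 0 < a < 1 -> 0 <= cval a w <= 1.
Proof.
move=> /andP[a0 a1]; elim: w => [|e w /andP[w0 w1]] /=; first
  by rewrite lexx ler01.
by case: e; rewrite ?mulr0 ?mulr1; apply/andP; split; nra.
Qed.

Lemma cval_cat a u v : cval a (u ++ v) = cval a u + a ^+ size u * cval a v.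
Proof.
elim: u => [|e u IH] /=; first by rewrite expr0 mul1r add0r.
by rewrite IH exprS; ring.
Qed.

Lemma cval_cat_itv a u v : 0 < a < 1 ->
  0 <= cval a (u ++ v) - cval a u <= a ^+ size u.
Proof.
move=> a01; rewrite cval_cat addrAC subrr add0r.
have /andP[v0 v1] := cval_itv v a01; have /andP[a0 _] := a01.
have := exprn_ge0 (size u) (ltW a0).
by move=> ?; rewrite mulr_ge0//= ler_piMr.
Qed.

Lemma cval_dist_le a v w : 0 < a < 1 -> size v = size w ->
  `|cval a v - cval a w| <= a ^+ fdiff v w.
Proof.
move=> a01; have /andP[a0 a1] := a01.
elim: v w => [|e v IH] [|e' w] //= ; first by rewrite subrr normr0 expr0 ler01.
move=> [vw]; case: eqVneq => [->|ne].
  rewrite opprD addrACA subrr add0r -mulrBr normrM (gtr0_norm a0) exprS.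
  by rewrite ler_pM2l// IH.
have /andP[v0 v1] := cval_itv v a01; have /andP[w0 w1] := cval_itv w a01.
by rewrite expr0 ler_norml; case: e e' ne => -[]//= _; rewrite ?mulr0 ?mulr1;
  apply/andP; split; nra.
Qed.

(** After the common prefix one tail lies in [0, a] and the other in [1 - a, 1], which leaves a gap
    of length 1 - 2a between them. *)
Lemma cval_dist_ge a v w : 0 < a < 2^-1 -> size v = size w ->
  (fdiff v w < size v)%N ->
  (1 - 2 * a) * a ^+ fdiff v w <= `|cval a v - cval a w|.
Proof.
move=> a012; have /andP[a0 a12] := a012; have a01 : 0 < a < 1 by lra.
elim: v w => [|e v IH] [|e' w] //= [vw]; case: eqVneq => [->|ne] lt.
  rewrite opprD addrACA subrr add0r -mulrBr normrM (gtr0_norm a0) exprS.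
  by rewrite mulrCA ler_pM2l// IH.
have /andP[v0 v1] := cval_itv v a01; have /andP[w0 w1] := cval_itv w a01.
rewrite expr0 mulr1 ler_normr.
by case: e e' ne => -[]//= _; rewrite ?mulr0 ?mulr1; apply/orP;
  [left|right]; nra.
Qed.

Lemma fdiff_le v w : (fdiff v w <= size v)%N.
Proof.
elim: v w => [|e v IH] [|e' w] //=.
by case: eqP => // _; exact: (leq_ltn_trans (IH w)).
Qed.

(** Two random words first differ at index [i] with probability 2^-(i+1) and coincide with
    probability 2^-m. Averages over pairs of words thus become sums over scales. *)
Lemma avg_fdiff m (g : nat -> R) :
  avg (words m) (fun v => avg (words m) (fun w => g (fdiff v w))) =
  \sum_(i < m) 2^-1 ^+ i.+1 * g i + 2^-1 ^+ m * g m.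
Proof.
elim: m g => [|m IH] g.
  by rewrite !avg_words0 big_ord0 add0r expr0 mul1r.
have D e : avg (words m) (fun v => avg (words m) (fun w =>
    g (fdiff (e :: v) (e :: w)))) =
    \sum_(i < m) 2^-1 ^+ i.+1 * g i.+1 + 2^-1 ^+ m * g m.+1.
  rewrite -(IH (g \o S)); apply: eq_avg => v _; apply: eq_avg => w _ /=.
  by rewrite eqxx.
have N e : avg (words m) (fun v => avg (words m) (fun w =>
    g (fdiff (e :: v) (~~ e :: w)))) = g 0.
  rewrite -[RHS](avg_words_cst m); apply: eq_avg => v _.
  rewrite -[RHS](avg_words_cst m); apply: eq_avg => w _ /=.
  by case: e.
rewrite avg_wordsS /comp.
under eq_avg do rewrite avg_wordsS.
rewrite avgZr avgD (D false) (N false).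
under [X in _ + X]eq_avg do rewrite avg_wordsS.
rewrite [X in _ + X]avgZr avgD (D true) (N true).
rewrite big_ord_recl /= expr1 exprS.
under [in RHS]eq_bigr do rewrite exprS -mulrA.
rewrite -mulr_sumr; set X := \sum_(_ < _) _.
by field.
Qed.

(** By [cval_dist_ge], the bound on [r] forces points within [r] of each other to share their first
    [i] digits, an event of probability 2^-i. *)
Lemma coll_cval_le a n i r : 0 < a < 2^-1 -> (i <= n)%N ->
  r * a < (1 - 2 * a) * a ^+ i -> coll (words n) (cval a) r <= 2^-1 ^+ i.
Proof.
move=> a012; have /andP[a0 a12] := a012; have a01 : 0 < a < 1 by lra.
move=> lein ra.
pose g j : R := (i <= j)%N%:R.
apply: (@le_trans _ _
  (avg (words n) (fun v => avg (words n) (fun w => g (fdiff v w))))).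
  apply: le_avg => v; rewrite mem_words => /eqP sv.
  apply: le_avg => w; rewrite mem_words => /eqP sw.
  case: (boolP (`|_| <= r)) => [le|_]; last by rewrite ler0n.
  rewrite /g; case: leqP => // lti; exfalso.
  have := @cval_dist_ge a v w a012; rewrite sv sw => /(_ erefl).
  move=> /(_ (leq_trans lti lein)) ge.
  have : a ^+ i <= a ^+ (fdiff v w) * a.
    by rewrite -exprSr; apply: ler_wiXn2l => //; lra.
  nra.
rewrite avg_fdiff /g lein mulr1.
(* What remains is the tail of the geometric law of [fdiff], evaluated by induction. *)
elim: n i lein {g ra} => [|n IH] [|i] //= lein; first by rewrite big_ord0 add0r.
  rewrite big_ord_recl /=; have := IH 0 (leq0n _).
  under eq_bigr do rewrite exprS -mulrA.
  by rewrite -mulr_sumr expr1 mulr1 expr0 exprS /=; set X := \sum_(_ < _) _;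
    lra.
rewrite big_ord_recl /= mulr0 add0r !exprS.
have := IH i lein; under [in X in _ -> X]eq_bigr do rewrite exprS -mulrA.
by rewrite -mulr_sumr; set X := \sum_(_ < _) _; lra.
Qed.

Definition wpairs n m := [seq (u, v) | u <- words n, v <- words m].

Lemma mem_wpairs n m p :
  (p \in wpairs n m) = (size p.1 == n) && (size p.2 == m).
Proof.
case: p => u v; rewrite -!mem_words; apply/allpairsP/idP => /= [|/andP[un vm]].
  by case=> -[u' v'] /= [? ? [-> ->]]; apply/andP.
by exists (u, v).
Qed.

Lemma avg_wpairs_cst n m (c : R) : avg (wpairs n m) (fun=> c) = c.
Proof. by rewrite avg_allpairs !avg_words_cst. Qed.

Lemma avg_wpairs_cat n m n' m' (F : seq bool * seq bool -> R) :
  avg (wpairs (n + n') (m + m')) F = avg (wpairs n m) (fun p =>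
    avg (wpairs n' m') (fun q => F (p.1 ++ q.1, p.2 ++ q.2))).
Proof.
rewrite !avg_allpairs avg_words_cat; apply: eq_avg => u _.
under eq_avg do rewrite avg_words_cat.
by rewrite exchange_avg; apply: eq_avg => v _; rewrite avg_allpairs.
Qed.

Definition pt a b lambda (p : seq bool * seq bool) : R :=
  cval a p.1 + lambda * cval b p.2.

Definition pcoll a b lambda n m r := coll (wpairs n m) (pt a b lambda) r.

Lemma pt_dist_le a b lambda p q : 0 < a < 1 -> 0 < b < 1 ->
  `|pt a b lambda p - pt a b lambda q| <= 1 + `|lambda|.
Proof.
move=> a01 b01; rewrite /pt opprD addrACA -mulrBr.
apply: (le_trans (ler_normD _ _)); rewrite normrM.
have /andP[? ?] := cval_itv p.1 a01; have /andP[? ?] := cval_itv q.1 a01.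
have /andP[? ?] := cval_itv p.2 b01; have /andP[? ?] := cval_itv q.2 b01.
apply: lerD; first by rewrite ler_norml; lra.
by rewrite ler_piMr// ler_norml; lra.
Qed.

(** Split each word into a prefix and a suffix and divide by a^n: the suffixes form a system with
    relative scale [lambda * b ^+ m / a ^+ n], shifted by the difference of the prefixes. That
    system has diameter at most 1 plus this scale in absolute value, so prefixes farther apart than
    [T * a ^+ n] never collide. For the others [avg_shift_le] with parameter 1 bounds the suffix
    average by 3 times the unshifted one, whatever the shift, and [coll_scale_le] turns [T * a ^+ n]
    back into a^n. *)
Lemma pcoll_submult a b lambda n m n' m' (T : nat) r : 0 < a < 1 -> 0 < b < 1 ->
  0 < r <= 1 -> 2 + `|lambda * b ^+ m / a ^+ n| <= T%:R ->
  pcoll a b lambda (n + n') (m + m') (a ^+ n * r) <=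
  (3 * (2 * T + 1))%:R * pcoll a b lambda n m (a ^+ n) *
    pcoll a b (lambda * b ^+ m / a ^+ n) n' m' r.
Proof.
move=> a01 b01 /andP[r0 r1]; set l' := lambda * _ / _ => TL.
have an0 : 0 < a ^+ n by apply: exprn_gt0; case/andP: a01.
pose h := pt a b l'; pose f := pt a b lambda.
rewrite {1}/pcoll /coll avg_wpairs_cat.
apply: (@le_trans _ _ (avg (wpairs n m) (fun p => avg (wpairs n m) (fun p' =>
    (`|f p - f p'| <= T%:R * a ^+ n)%R%:R * (3 * pcoll a b l' n' m' r))))).
  apply: le_avg => p; rewrite mem_wpairs => /andP[/eqP p1 /eqP p2].
  under eq_avg do rewrite avg_wpairs_cat.
  rewrite exchange_avg; apply: le_avg => p'.
  rewrite mem_wpairs => /andP[/eqP p'1 /eqP p'2].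
  have E q q' :
      `|pt a b lambda (p.1 ++ q.1, p.2 ++ q.2) -
        pt a b lambda (p'.1 ++ q'.1, p'.2 ++ q'.2)| <= a ^+ n * r =
      (`|h q - h q' - (f p' - f p) / a ^+ n| <= 1%:R * r) .
    rewrite mul1r -[RHS](ler_pM2l an0) -[X in _ = (X * _ <= _)](gtr0_norm an0).
    rewrite -normrM; congr (`|_| <= _).
    rewrite /h /f /pt /= !cval_cat p1 p2 p'1 p'2 /l'.
    by field; rewrite gt_eqF.
  case: (boolP (`|f p - f p'| <= _)) => [_|far].
    rewrite mul1r; apply: le_trans (avg_shift_le _ h 1 _ r0).
    by apply: le_avg => q _; apply: le_avg => q' _; rewrite E.
  rewrite mul0r -[0](avg_wpairs_cst n' m') le_avg// => q _.
  rewrite -[0](avg_wpairs_cst n' m') le_avg// => q' _.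
  rewrite E mul1r; case: (boolP (_ <= r)) => // near; exfalso.
  move/negP: far; apply.
  rewrite -ler_pdivrMr// -[X in _ / X](gtr0_norm an0) -normf_div.
  apply: le_trans TL.
  have -> : (f p - f p') / a ^+ n =
    (h q - h q' - (f p' - f p) / a ^+ n) - (h q - h q') by ring.
  apply: (le_trans (ler_normB _ _)).
  have := pt_dist_le l' q q' a01 b01; rewrite -/h; lra.
under eq_avg do rewrite avgZr.
rewrite avgZr -/(coll (wpairs n m) f (T%:R * a ^+ n)) natrM mulrA.
rewrite ler_wpM2r ?coll_ge0// [leLHS]mulrC -mulrA ler_pM2l//.
exact: coll_scale_le.
Qed.

(** The tails removed from the two second words both contribute a number in [0, b^m], so their
    difference is at most b^m, not twice that. *)
Lemma pcoll_truncate a b lambda n m k r : 0 < a < 1 -> 0 < b < 1 ->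
  pcoll a b lambda n (m + k) r <= pcoll a b lambda n m (r + `|lambda| * b ^+ m).
Proof.
move=> a01 b01; rewrite {1}/pcoll /coll -[n in wpairs n (m + k)]addn0.
rewrite avg_wpairs_cat.
apply: (@le_trans _ _ (avg (wpairs n m) (fun p => avg (wpairs n m) (fun p' =>
   (`|pt a b lambda p - pt a b lambda p'| <= r + `|lambda| * b ^+ m)%R%:R)))) => //.
apply: le_avg => p; rewrite mem_wpairs => /andP[/eqP p1 /eqP p2].
rewrite -[X in _ <= X](avg_wpairs_cst 0 k); apply: le_avg => q.
rewrite mem_wpairs size_eq0 => /andP[/eqP q1 _].
rewrite avg_wpairs_cat; apply: le_avg => p'.
rewrite mem_wpairs => /andP[/eqP p'1 /eqP p'2].
rewrite -[X in _ <= X](avg_wpairs_cst 0 k); apply: le_avg => q'.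
rewrite mem_wpairs size_eq0 => /andP[/eqP q'1 _].
case: (boolP (_ <= r)) => [|_]; last by rewrite ler0n.
rewrite /pt /= q1 q'1 !cats0 => le.
suff -> : `|cval a p.1 + lambda * cval b p.2 -
            (cval a p'.1 + lambda * cval b p'.2)| <= r + `|lambda| * b ^+ m
              by [].
set x := cval a p.1; set x' := cval a p'.1.
have -> : x + lambda * cval b p.2 - (x' + lambda * cval b p'.2) =
   (x + lambda * cval b (p.2 ++ q.2) - (x' + lambda * cval b (p'.2 ++ q'.2))) -
   lambda * ((cval b (p.2 ++ q.2) - cval b p.2) -
             (cval b (p'.2 ++ q'.2) - cval b p'.2)) by ring.
apply: (le_trans (ler_normB _ _)); apply: lerD => //.
rewrite normrM ler_wpM2l//.
have := cval_cat_itv p.2 q.2 b01; have := cval_cat_itv p'.2 q'.2 b01.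
by rewrite p2 p'2 ler_norml; lra.
Qed.

End Words.

(** * Visits of an irrational rotation *)

Section IrrationalRotation.
Context {R : realType}.
Implicit Types (x alpha e : R).

Definition frac x : R := x - (Num.floor x)%:~R.

Lemma frac_itv x : 0 <= frac x < 1.
Proof. by have := floor_itv x; rewrite /frac intrD; lra. Qed.

Lemma irrational_mulz alpha (q : nat) (p : int) :
  irrational alpha -> (0 < q)%N -> q%:R * alpha != p%:~R.
Proof.
move=> irr q0; apply/eqP => qp; apply: irr.
exists (p%:~R / q%:R) => //=; rewrite fmorph_div /= ratr_int ratr_nat.
by rewrite -qp mulrAC mulfV ?mul1r// pnatr_eq0 -lt0n.
Qed.

(** Dirichlet's pigeonhole: M + 1 fractional parts fall into M boxes of length 1/M < e. *)
Lemma irrational_small_multiple alpha e : irrational alpha -> 0 < e ->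
  exists q : nat, exists p : int,
    (0 < q)%N /\ 0 < `|q%:R * alpha - p%:~R| <= e.
Proof.
move=> irr e0; pose M := (Num.truncn e^-1).+1.
have M0 : 0 < M%:R :> R by rewrite ltr0n.
have Me : M%:R^-1 < e.
  by rewrite invf_plt ?posrE//; exact: truncnS_gt.
pose x i := M%:R * frac (i%:R * alpha).
have x0 i : 0 <= x i by rewrite mulr_ge0//; have /andP[] :=
  frac_itv (i%:R * alpha).
have xM i : (Num.truncn (x i) < M)%N.
  rewrite -(ltr_nat R); apply: le_lt_trans (_ : _ <= x i) _.
    by have /andP[] := truncn_itv (x0 i).
  by rewrite gtr_pMr//; have /andP[] := frac_itv (i%:R * alpha).
pose f (i : 'I_M.+1) := Ordinal (xM i).
have : ~~ injectiveb f.
  by apply/injectiveP => /leq_card; rewrite !card_ord ltnn.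
move=> /injectivePn[i [j ij /(congr1 val)/= fij]].
have close : `|frac (i%:R * alpha) - frac (j%:R * alpha)| < M%:R^-1.
  rewrite -(ltr_pM2l M0) mulfV ?gt_eqF// -[X in X * _](gtr0_norm M0) -normrM.
  rewrite mulrBr -/(x i) -/(x j).
  have := truncn_itv (x0 i); have := truncn_itv (x0 j); rewrite fij.
  by rewrite ltr_norml -natr1; lra.
wlog ltij : i j ij close {fij} / (j < i)%N.
  case: (ltngtP j i) => [lt h|lt h|/val_inj eq].
  - exact: (h i j).
  - by apply: (h j i) => //; [rewrite eq_sym|rewrite distrC].
  - by rewrite eq eqxx in ij.
exists (i - j)%N, (Num.floor (i%:R * alpha) - Num.floor (j%:R * alpha)).
split; first by rewrite subn_gt0.
apply/andP; split.
  by rewrite normr_gt0 subr_eq0 irrational_mulz// subn_gt0.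
apply/ltW/(lt_trans _ Me)/(le_lt_trans _ close).
rewrite natrB 1?ltnW// intrB /frac le_eqVlt; apply/orP; left; apply/eqP.
by congr (`|_|); ring.
Qed.

(** Multiples of a step of length at most [e] cannot jump over the interval from [e] to [2 * e]. *)
Lemma irrational_multiple_itv alpha e : irrational alpha -> 0 < e ->
  exists q : nat, exists p : int, e < `|q%:R * alpha - p%:~R| <= 2 * e.
Proof.
move=> irr e0; have [q [p [q0 /andP[]]]] := irrational_small_multiple irr e0.
set d := `|_| => d0 de; pose s := (Num.truncn (e / d)).+1.
have ed0 : 0 <= e / d by rewrite divr_ge0// ltW.
exists (s * q)%N, (s%:Z * p).
have -> : (s * q)%:R * alpha - (s%:Z * p)%:~R = s%:R * (q%:R * alpha - p%:~R).
  by rewrite natrM intrM; ring.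
rewrite normrM -/d normr_nat.
have := truncn_itv ed0; rewrite ler_pdivlMr// ltr_pdivrMr// -/s.
by rewrite -[s%:R]natr1 => /andP[]; set t := _%:R => ? ?; apply/andP; split;
  lra.
Qed.

(* A point of the orbit of [0] lying in an arc of length [l] stays out of this
   arc under the first [N] iterates of a rotation by an angle [q alpha - p]
   between [l] and [2 l]: the visits to the arc have [N] disjoint translates. *)
Lemma visits_le alpha l : irrational alpha -> 0 < l ->
  exists Q : nat, forall (k : nat) (S : pred nat),
    (forall i j, S i -> S j ->
       `|frac (i%:R * alpha) - frac (j%:R * alpha)| <= l) ->
    \sum_(j < k) (S j)%:R <= 8 * l * k%:R + Q%:R :> R.
Proof.
move=> irr l0; case: (leP 1 (8 * l)) => [l8|l8].
  exists 0 => k S _; rewrite addr0.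
  apply: (@le_trans _ _ k%:R); last by rewrite ler_peMl.
  rewrite -[X in _ <= X%:R]card_ord -sum1_card natr_sum.
  by apply: ler_sum => j _; case: (S j); rewrite ?ler01.
have [q [p /andP[]]] := irrational_multiple_itv irr l0.
set d := q%:R * alpha - p%:~R => d1 d2.
(* This [N] satisfies 4lN <= 1 <= 8lN. The first inequality keeps the [N] translates from wrapping
   around the circle; the second turns the final bound k/N + q on the number of visits into 8lk +
   q. *)
pose N := Num.truncn (4 * l)^-1.
have l4 : 0 <= (4 * l)^-1 by rewrite invr_ge0; lra.
have N1 : N%:R * (4 * l) <= 1.
  by have /andP[+ _] := truncn_itv l4; rewrite -/N -ler_pdivlMr ?div1r; lra.
have N2 : 1 <= N%:R * (8 * l).
  have /andP[_] := truncn_itv l4; rewrite -/N -[(4 * l)^-1]div1r.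
  by rewrite ltr_pdivrMr -?natr1; lra.
exists q => k S close.
pose A := [set j : 'I_k | S j]%SET.
have -> : \sum_(j < k) (S j)%:R = #|A|%:R :> R.
  rewrite -sum1_card natr_sum [RHS]big_mkcond; apply: eq_bigr => j _.
  by rewrite inE; case: (S j).
have lt (y : 'I_k * 'I_N) : (y.1 + q * y.2 < k + q * N)%N.
  by case: y => j i /=; rewrite -addSn leq_add// leq_mul2l ltnW ?orbT.
pose F y := Ordinal (lt y).
(* If j + q i = j' + q i' with i and i' distinct, the fractional parts at j and j' differ by (i' -
   i) d plus an integer. The first term has absolute value strictly between l and 1 - l, so the
   integer must be 0, and then the two visits are more than l apart. *)
have injF : {in finset.setX A [set: 'I_N]%SET &, injective F}.
  move=> [j i] [j' i'] /finset.setXP[/= Aj _] /finset.setXP[/= Aj' _] /(congr1 val) /= E.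
  rewrite !inE in Aj Aj'.
  have [ii|ii] := eqVneq i i'.
    by move: E; rewrite ii => /addIn/val_inj ->.
  exfalso.
  have := close _ _ Aj Aj'.
  pose z : int := (i'%:Z - i%:Z) * p - Num.floor (j%:R * alpha) +
     Num.floor (j'%:R * alpha).
  have jE : j%:R + q%:R * i%:R = j'%:R + q%:R * i'%:R :> R.
    by rewrite -!natrM -!natrD E.
  have fE : frac (j%:R * alpha) - frac (j'%:R * alpha) =
      (i'%:R - i%:R) * d + z%:~R.
    have jj : j%:R * alpha = j'%:R * alpha + q%:R * (i'%:R - i%:R) * alpha.
      by rewrite -mulrDl; congr (_ * _); lra.
    rewrite /frac /z /d !(intrD, intrM, intrN).
    move: (Num.floor (j%:R * alpha)) (Num.floor (j'%:R * alpha)) => F1 F2.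
    by rewrite jj /=; ring.
  have iN := ltn_ord i; have iN' := ltn_ord i'.
  have tE : `|i'%:R - i%:R| = (absz (i'%:Z - i%:Z)%R)%:R :> R.
    by rewrite natr_absz intr_norm intrB.
  have ii' : nat_of_ord i != nat_of_ord i' by apply: contra ii =>
    /eqP/val_inj ->.
  have t1 : `|i'%:R - i%:R| + 1 <= N%:R :> R 
    by rewrite tE natr1 ler_nat; move: iN iN'; clear; lia.
  have t0 : 1 <= `|i'%:R - i%:R| :> R 
    by rewrite tE ler1n; move: ii'; clear; lia.
  have td1 : l < `|(i'%:R - i%:R) * d|.
    by rewrite normrM; apply: lt_le_trans d1 _; rewrite ler_peMl.
  have td2 : `|(i'%:R - i%:R) * d| + l < 1.
    rewrite normrM; have := ler_wpM2l (normr_ge0 (i'%:R - i%:R)) d2.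
    have : (`|i'%:R - i%:R| + 1) * (4 * l) <= N%:R * (4 * l).
      by rewrite ler_wpM2r//; lra.
    by rewrite mulrDl; lra.
  rewrite fE => zl.
  have : `|z%:~R| < 1 :> R.
    apply: le_lt_trans td2; rewrite addrC.
    have -> : z%:~R = ((i'%:R - i%:R) * d + z%:~R) - (i'%:R - i%:R) * d by lra.
    by apply: (le_trans (ler_normB _ _)); rewrite lerD2r.
  rewrite -intr_norm -[1]/(1%:~R) ltr_int => z1.
  have z0 : z = 0 by move: (z) z1; clear => x; lia.
  by move: zl; rewrite z0 addr0; lra.
have : (#|A| * N <= k + q * N)%N.
  rewrite -[N in (#|A| * N)%N]card_ord -finset.cardsT -finset.cardsX -(card_in_imset injF).
  by apply: (leq_trans (max_card _)); rewrite card_ord.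
rewrite -(ler_nat R) natrD !natrM => cA.
have kN : k%:R <= k%:R * (N%:R * (8 * l)) by rewrite ler_peMr.
have N0 : 0 < N%:R :> R.
  by rewrite ltr0n lt0n; apply: contraTneq N2 => ->; rewrite mul0r; lra.
by rewrite -(ler_pM2r N0); lra.
Qed.

End IrrationalRotation.

(** * Decay of the collision sums *)

Section Digits.
Context {R : realType}.
Implicit Types (a b : R).

(* The similarity dimension of [cantor_set a]. *)
Definition sdim a : R := - (ln 2 / ln a).

(* [digits a b n] digits in base [b] reach the precision of [n] digits in base
   [a]. *)
Definition digits a b (n : nat) : nat := Num.truncn (n%:R * (ln a / ln b)).

Lemma lt01_of a : 0 < a < 2^-1 -> 0 < a < 1.
Proof. by move=> ?; lra. Qed.

Lemma ln_lt0_of a : 0 < a < 1 -> ln a < 0.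
Proof. by move=> /andP[a0 a1]; rewrite ln_lt0// a0. Qed.

Lemma expnE a n : 0 < a -> a ^+ n = expR (n%:R * ln a).
Proof. by move=> a0; rewrite expRM_natl lnK. Qed.

Lemma powRE a x : 0 < a -> a `^ x = expR (x * ln a).
Proof. by move=> a0; rewrite /powR gt_eqF. Qed.

Lemma powR_mulB (x s t : R) : 0 < x -> x `^ s * x `^ (t - s) = x `^ t.
Proof. by move=> x0; rewrite !powRE// -expRD -mulrDl addrC subrK. Qed.

Lemma powR_expn (x s : R) n : 0 < x -> (x ^+ n) `^ s = (x `^ s) ^+ n.
Proof.
move=> x0; rewrite !powRE ?exprn_gt0// -expRM_natl.
by rewrite lnXn// -[_ *+ n]mulr_natl mulrCA.
Qed.

Lemma sdim_gt0 a : 0 < a < 1 -> 0 < sdim a.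
Proof.
move=> /ln_lt0_of a0; rewrite /sdim -mulrN -invrN divr_gt0 ?oppr_gt0//.
by rewrite ln_gt0// ltr1n.
Qed.

Lemma expn_sdim a n : 0 < a < 1 -> (a ^+ n) `^ sdim a = 2^-1 ^+ n.
Proof.
move=> a01; have /andP[a0 _] := a01; have l0 := ln_lt0_of a01.
rewrite powRE ?exprn_gt0// lnXn// expnE ?invr_gt0// lnV ?posrE// /sdim.
by congr expR; rewrite -mulr_natl; field; rewrite lt_eqF.
Qed.

Section TwoBases.
Variables (a b : R).
Hypotheses (a01 : 0 < a < 1) (b01 : 0 < b < 1).

Let a0 : 0 < a. Proof. by case/andP: a01. Qed.
Let b0 : 0 < b. Proof. by case/andP: b01. Qed.
Let la : ln a < 0. Proof. exact: ln_lt0_of. Qed.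
Let lb : ln b < 0. Proof. exact: ln_lt0_of. Qed.

Lemma ratio_gt0 : 0 < ln a / ln b.
Proof. by rewrite -mulrNN -invrN divr_gt0 ?oppr_gt0. Qed.

Lemma digits_itv n :
  (digits a b n)%:R <= n%:R * (ln a / ln b) < (digits a b n)%:R + 1.
Proof.
rewrite natr1; apply: truncn_itv.
by rewrite mulr_ge0 ?ler0n// ltW// ratio_gt0.
Qed.

Lemma digits_frac n :
  frac (n%:R * (ln a / ln b)) = n%:R * (ln a / ln b) - (digits a b n)%:R.
Proof.
have x0 : 0 <= n%:R * (ln a / ln b)
  by rewrite mulr_ge0 ?ler0n// ltW// ratio_gt0.
by rewrite /frac /digits truncn_floor x0 natr_absz ger0_norm// floor_ge0.
Qed.

Lemma digits0 : digits a b 0 = 0.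
Proof. by rewrite /digits mul0r truncn0. Qed.

(** Rounding down is superadditive, so the truncated subtractions are exact. The excess is isolated
    at the end so that [pcoll_truncate] can drop it. *)
Lemma digits_add n k :
  digits a b (n + k) =
  (digits a b n + (digits a b k + (digits a b (n + k) - digits a b n - digits a b k)))%N.
Proof.
suff : (digits a b n + digits a b k < (digits a b (n + k)).+1)%N by lia.
rewrite -(ltr_nat R) natrD -natr1.
have := digits_itv n; have := digits_itv k; have := digits_itv (n + k).
by rewrite natrD; set t := _ / _; lra.
Qed.

Lemma le_expn_digits n : a ^+ n <= b ^+ digits a b n.
Proof.
rewrite !expnE// ler_expR; have /andP[+ _] := digits_itv n.
by rewrite mulrA -(ler_nM2r lb) mulfVK// lt_eqF.
Qed.

Lemma expn_digits_lt n : b ^+ digits a b n * b < a ^+ n.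
Proof.
rewrite -exprSr !expnE// ltr_expR; have /andP[_ +] := digits_itv n.
by rewrite mulrA -(ltr_nM2r lb) mulfVK ?natr1// lt_eqF.
Qed.

(** Origin of the rotation: the relative scale depends on [n] only through the fractional part of
    [n * (ln a / ln b)]. *)
Lemma expn_digits_ratio n :
  b ^+ digits a b n / a ^+ n = expR (frac (n%:R * (ln a / ln b)) * - ln b).
Proof.
rewrite digits_frac !expnE// -expRN -expRD; congr expR.
by field; rewrite lt_eqF.
Qed.

End TwoBases.

(** The scale b^i is converted into j = [digits b a i] digits in base [a], available since i <=
    [digits a b n]. Rounding costs one digit in base [a], hence the factor 2, which is a^(-sdim
    a). *)
Lemma coll_cval_digits a b (T n i : nat) : 0 < a < 2^-1 -> 0 < b < 1 ->
  (i <= digits a b n)%N ->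
  coll (words n) (cval a) (T%:R * ((1 - 2 * a) * b ^+ i)) <=
  (2 * T + 1)%:R * (2 * (b ^+ i) `^ sdim a).
Proof.
move=> a012 b01 lei; have a01 := lt01_of a012.
have /andP[a0 _] := a01; have /andP[b0 _] := b01.
have la := ln_lt0_of a01; have lb := ln_lt0_of b01.
have /andP[_ a12] := a012.
have r0 : 0 < (1 - 2 * a) * b ^+ i by rewrite mulr_gt0 ?exprn_gt0//; lra.
apply: (le_trans (coll_scale_le _ _ _ r0)); rewrite ler_wpM2l//.
set j := digits b a i.
have jn : (j <= n)%N.
  rewrite -(ler_nat R); apply: (@le_trans _ _ (i%:R * (ln b / ln a))).
    by have /andP[] := digits_itv b01 a01 i.
  have : i%:R <= n%:R * (ln a / ln b).
    apply: (le_trans _ (proj1 (andP (digits_itv a01 b01 n)))).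
    by rewrite ler_nat.
  rewrite -(ler_pM2r (ratio_gt0 b01 a01)) => /le_trans; apply.
  by rewrite -mulrA mulf_div [ln b * _]mulrC divff ?mulr1// mulf_neq0 ?lt_eqF.
apply: (@le_trans _ _ (2^-1 ^+ j)).
  apply: coll_cval_le => //; rewrite -mulrA ltr_pM2l; last by lra.
  have /andP[_ a1] := a01.
  apply: (@lt_le_trans _ _ (b ^+ i)); last exact: le_expn_digits.
  by rewrite gtr_pMr// exprn_gt0.
rewrite -(expn_sdim _ a01).
have : (a ^+ j * a) `^ sdim a <= (b ^+ i) `^ sdim a.
  apply: ge0_ler_powR; rewrite ?nnegrE ?mulr_ge0 ?exprn_ge0 ?ltW//.
  - exact: sdim_gt0.
  - exact: expn_digits_lt.
have aE : a `^ sdim a = 2^-1 by have := expn_sdim 1 a01; rewrite !expr1.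
by rewrite powRM ?exprn_ge0 ?(ltW a0)// aE; lra.
Qed.

(** Bound x^sigma by x^D, since D <= sigma and x <= 1, then x^(D-1) by y^(D-1), since D <= 1 and y
    <= x. This treats both cases of the minimum at once. *)
Lemma powR_min_le (x y D sigma : R) : 0 < y <= x -> x <= 1 -> D <= 1 ->
  D <= sigma -> x `^ sigma / x * y <= y `^ D.
Proof.
move=> /andP[y0 yx] x1 D1 Ds; have x0 : 0 < x by lra.
rewrite -{1}[y]powRr1 ?(ltW y0)// -(powR_mulB D 1 y0) mulrCA ler_piMr ?powR_ge0//.
rewrite mulrAC ler_pdivrMr// mul1r.
apply: (@le_trans _ _ (x `^ D * x `^ (1 - D))).
  apply: ler_pM; rewrite ?powR_ge0//.
    by apply: ger_powR => //; rewrite x0.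
  by apply: ge0_ler_powR; rewrite ?nnegrE//; lra.
by rewrite powR_mulB// powRr1// ltW.
Qed.

Lemma irrational_mul_inv (x : R) (n : nat) :
  irrational x -> (0 < n)%N -> irrational (n%:R * x^-1).
Proof.
move=> irr n0 [q _ qE]; apply: irr; exists (n%:R / q) => //.
rewrite fmorph_div /= ratr_nat qE invfM invrK mulrA divff ?mul1r//.
by rewrite pnatr_eq0 -lt0n.
Qed.

(** * Transversality along the orbit of relative scales *)

Section Decay.
Variables (a b lambda : R).
Hypotheses (ha : 0 < a < 2^-1) (hb : 0 < b < 2^-1) (l0 : lambda != 0).
Hypothesis irr : irrational (ln b / ln a).

Let a01 := lt01_of ha.
Let b01 := lt01_of hb.
Let a0 : 0 < a. Proof. by case/andP: ha. Qed.
Let b0 : 0 < b. Proof. by case/andP: hb. Qed.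
Let la : ln a < 0. Proof. exact: ln_lt0_of. Qed.
Let lb : ln b < 0. Proof. exact: ln_lt0_of. Qed.
Let nl0 : 0 < `|lambda|. Proof. by rewrite normr_gt0. Qed.

(* The relative scale of the second factor seen at the scale [a ^+ n]. *)
Definition relscale n := lambda * b ^+ digits a b n / a ^+ n.

Lemma relscale_le n : `|relscale n| <= `|lambda| / b.
Proof.
have an : 0 < a ^+ n by exact: exprn_gt0.
have bn : 0 < b ^+ digits a b n by exact: exprn_gt0.
rewrite /relscale !normrM normfV (gtr0_norm an) (gtr0_norm bn).
rewrite -mulrA ler_wpM2l// ler_pdivrMr// mulrC ler_pdivlMr//.
exact/ltW/expn_digits_lt.
Qed.

(** By [expn_digits_ratio], the relative scale is [lambda] times the exponential of a nonnegative
    number, and the exponential expands distances there. *)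
Lemma relscale_dist_ge n n' :
  `|frac (n%:R * (ln a / ln b)) - frac (n'%:R * (ln a / ln b))| *
    (`|lambda| * - ln b) <= `|relscale n - relscale n'|.
Proof.
rewrite /relscale -!mulrA -mulrBr !expn_digits_ratio// normrM.
rewrite mulrCA ler_wpM2l//.
set x := frac _; set y := frac _.
have x0 : 0 <= x by have /andP[] := frac_itv (n%:R * (ln a / ln b)).
have y0 : 0 <= y by have /andP[] := frac_itv (n'%:R * (ln a / ln b)).
clearbody x y; wlog xy : x y x0 y0 / x <= y.
  move=> h; case: (leP x y) => [|/ltW] xy; first exact: h.
  by rewrite distrC [leRHS]distrC; exact: h.
have E s t : 0 <= s -> s <= t -> t - s <= expR t - expR s.
  move=> s0 st; rewrite -[in expR t](subrK s t) expRD.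
  have := expR_ge1Dx (t - s); have := expR_ge1Dx s; nra.
rewrite distrC [leRHS]distrC ger0_norm ?subr_ge0// mulrBl.
apply: le_trans (ler_norm _); apply: E.
- by rewrite mulr_ge0// oppr_ge0 ltW.
- by rewrite ler_wpM2r// oppr_ge0 ltW.
Qed.

(** The enlargement of the radius a^L caused in [pcoll_step] by dropping excess digits: the relative
    scale is at most |lambda|/b, and b^m at most a^L/b for m = [digits a b L]. *)
Local Notation K := (1 + `|lambda| / b / b).
Local Notation D := (Num.min (sdim a + sdim b) 1).

Let K_gt0 : 0 < K.
Proof. by rewrite addr_gt0// !divr_gt0. Qed.

(** Exchange the sum over [j] with the averages and fix a pair whose second words first differ at
    [i], so that their second coordinates differ by about b^i. A collision forces the first
    coordinates to be within a multiple of b^i, and it confines the relative scale to an interval of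
    length about a^L / b^i, which the orbit visits with the corresponding frequency. Averaging over
    first words and then over [i] gives terms bounded by [powR_min_le]. Here [C] does not depend on
    [L], nor [Q] on [k]. *)
Lemma sum_pcoll_le : exists2 C : R, 0 < C & forall L, (0 < L)%N ->
  exists Q : R, forall k : nat,
  \sum_(j < k) pcoll a b (relscale (j * L)) L (digits a b L) (K * a ^+ L) <=
  C * L.+1%:R * (a ^+ L) `^ D * k%:R + Q.
Proof.
(* A collision bounds the difference of first coordinates by (|lambda|/b + K) b^i; [T] expresses
   this in units of (1 - 2a) b^i, as [coll_cval_digits] expects. *)
pose T := (Num.truncn ((`|lambda| / b + K) / (1 - 2 * a))).+1.
have a2 : 0 < 1 - 2 * a by move: ha; lra.
have b2 : 0 < 1 - 2 * b by move: hb; lra.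
have b1 : b < 1 by move: hb; lra.
have TK : `|lambda| / b + K <= T%:R * (1 - 2 * a).
  by rewrite -ler_pdivrMr// ltW// truncnS_gt.
(* The triangle inequality gives 2K, the separation of the second coordinates 1 - 2b, and
   [relscale_dist_ge] the factor |lambda| (- ln b). *)
pose C' := 2 * K / (1 - 2 * b) / (`|lambda| * - ln b).
have lc : 0 < `|lambda| * - ln b by rewrite mulr_gt0// oppr_gt0.
have C'0 : 0 < C' by rewrite !divr_gt0// mulr_gt0.
pose th := ln a / ln b.
have th0 : 0 < th by exact: ratio_gt0.
(* The first summand collects the scales i < M, at most (L+1) th in number; the second comes from
   pairs with equal second words. *)
exists ((2 * T + 1)%:R * (8 * C' * th + 2 / b)) => [|L L0].
  apply: mulr_gt0; first by rewrite ltr0n addn1.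
  by apply: addr_gt0; [apply: mulr_gt0 => //; apply: mulr_gt0|apply: divr_gt0].
set M := digits a b L.
have aL : 0 < a ^+ L by exact: exprn_gt0.
pose l i := C' * a ^+ L / b ^+ i.
have l_gt0 i : 0 < l i by rewrite divr_gt0 ?exprn_gt0// mulr_gt0.
have irrL : irrational (L%:R * th).
  by rewrite /th -[ln a / ln b]invf_div; exact: irrational_mul_inv.
have /choice[Q QP] : forall i : nat, exists Q : nat, forall (k : nat) (S : pred nat),
    (forall j j', S j -> S j' ->
       `|frac (j%:R * (L%:R * th)) - frac (j'%:R * (L%:R * th))| <= l i) ->
    \sum_(j < k) (S j)%:R <= 8 * l i * k%:R + Q%:R :> R.
  by move=> i; exact: visits_le.
exists ((2 * T + 1)%:R * \sum_(i < M) (Q i)%:R) => k.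
(* A bound on the number of colliding [j]. The value i = M means equal second words: the relative
   scale then has no influence, and all [k] indices are counted. *)
pose W i := if (i < M)%N then 8 * l i * k%:R + (Q i)%:R else k%:R : R.
have W0 i : 0 <= W i.
  rewrite /W; case: ifP => // _; apply: addr_ge0 => //.
  by apply: mulr_ge0 => //; apply: mulr_ge0 => //; exact: ltW.
have pw p q : p \in wpairs L M -> q \in wpairs L M ->
    \sum_(j < k) (`|pt a b (relscale (j * L)) p - pt a b (relscale (j * L)) q|
      <= K * a ^+ L)%R%:R <=
    (`|cval a p.1 - cval a q.1| <=
      T%:R * ((1 - 2 * a) * b ^+ fdiff p.2 q.2))%R%:R * W (fdiff p.2 q.2) :> R.
  rewrite !mem_wpairs => /andP[/eqP p1 /eqP p2] /andP[/eqP q1 /eqP q2].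
  have fM : (fdiff p.2 q.2 <= M)%N by rewrite -p2 fdiff_le.
  set i := fdiff _ _ in fM *.
  have bi : a ^+ L <= b ^+ i.
    by apply: (le_trans (le_expn_digits a01 b01 L)); apply: ler_wiXn2l;
      rewrite ?ltW.
  have dy : `|cval b p.2 - cval b q.2| <= b ^+ i.
    by apply: cval_dist_le; rewrite ?p2 ?q2.
  have dE (r : R) : pt a b r p - pt a b r q =
      (cval a p.1 - cval a q.1) + r * (cval b p.2 - cval b q.2).
    by rewrite /pt; ring.
  case: (boolP (`|cval a p.1 - cval a q.1| <= _)) => [_|far]; last first.
    rewrite mul0r big1// => j _; case: (boolP (_ <= K * _)) => // near; exfalso.
    move/negP: far; apply.
    apply: (@le_trans _ _ ((`|lambda| / b + K) * b ^+ i)); last first.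
      by rewrite mulrA ler_wpM2r// exprn_ge0// ltW.
    move: near; rewrite dE; set r := relscale _ => near.
    have -> : cval a p.1 - cval a q.1 = (cval a p.1 - cval a q.1 +
      r * (cval b p.2 - cval b q.2)) - r * (cval b p.2 - cval b q.2) by ring.
    apply: (le_trans (ler_normB _ _)); rewrite addrC mulrDl; apply: lerD.
      by rewrite normrM; apply: ler_pM => //; exact: relscale_le.
    by apply: (le_trans near); rewrite ler_wpM2l// ltW.
  rewrite mul1r /W; case: ltnP => [iM|_]; last first.
    rewrite -[X in _ <= X%:R]card_ord -sum1_card natr_sum.
    by apply: ler_sum => j _; rewrite ler_nat leq_b1.
  pose S j := `|pt a b (relscale (j * L)) p - pt a b (relscale (j * L)) q| <=
    K * a ^+ L.
  apply: (QP i k S) => j j' Sj Sj'.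
  have dy' : (1 - 2 * b) * b ^+ i <= `|cval b p.2 - cval b q.2|.
    by apply: cval_dist_ge; rewrite ?p2 ?q2.
  have := relscale_dist_ge (j * L) (j' * L).
  rewrite !natrM -!(mulrA _ L%:R) -/th.
  have : `|relscale (j * L) - relscale (j' * L)| * ((1 - 2 * b) * b ^+ i) <=
      2 * K * a ^+ L.
    apply: (@le_trans _ _ (`|relscale (j * L) - relscale (j' * L)| *
      `|cval b p.2 - cval b q.2|)); first by rewrite ler_wpM2l.
    rewrite -normrM.
    (* Subtracting the relations at [j] and [j'] eliminates the first coordinates. *)
    have -> : (relscale (j * L) - relscale (j' * L)) *
        (cval b p.2 - cval b q.2) =
      (pt a b (relscale (j * L)) p - pt a b (relscale (j * L)) q) -
      (pt a b (relscale (j' * L)) p - pt a b (relscale (j' * L)) q).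
      by rewrite !dE; ring.
    by apply: (le_trans (ler_normB _ _)); move: Sj Sj'; rewrite /S; lra.
  rewrite -ler_pdivlMr ?mulr_gt0 ?exprn_gt0// => h1 h2.
  have := le_trans h2 h1; rewrite -ler_pdivlMr// => /le_trans; apply.
  rewrite /l /C' le_eqVlt; apply/orP; left; apply/eqP.
  by field;
    rewrite ?(gt_eqF b2) ?(gt_eqF nl0) ?(lt_eqF lb) ?expf_neq0 ?(gt_eqF b0).
pose G i := (2 * T + 1)%:R * (2 * (b ^+ i) `^ sdim a) * W i.
apply: (@le_trans _ _ (avg (words M) (fun v => avg (words M) (fun w =>
    G (fdiff v w))))).
  rewrite /pcoll /coll -avg_sum.
  under eq_avg do rewrite -avg_sum.
  apply: (@le_trans _ _ (avg (wpairs L M) (fun p => avg (wpairs L M) (fun q =>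
    (`|cval a p.1 - cval a q.1| <=
      T%:R * ((1 - 2 * a) * b ^+ fdiff p.2 q.2))%R%:R * W (fdiff p.2 q.2))))).
    by apply: le_avg => p pw'; apply: le_avg => q qw'; exact: pw.
  rewrite avg_allpairs exchange_avg /=; apply: le_avg => v.
  rewrite mem_words => /eqP sv.
  under eq_avg do rewrite avg_allpairs exchange_avg /=.
  rewrite exchange_avg; apply: le_avg => w _.
  under eq_avg do rewrite avgZr.
  rewrite avgZr ler_wpM2r//.
  by apply: coll_cval_digits; rewrite // -/M -sv fdiff_le.
have sE i : 2^-1 ^+ i * (b ^+ i) `^ sdim a = (b ^+ i) `^ (sdim a + sdim b).
  by rewrite -(expn_sdim i b01) !powRE ?exprn_gt0// -expRD -mulrDl addrC.
have Ds : D <= sdim a + sdim b by rewrite ge_min lexx.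
have D1 : D <= 1 by rewrite ge_min lexx orbT.
have bi1 i : b ^+ i <= 1 by apply: exprn_ile1; exact: ltW.
have D0 : 0 < D by rewrite lt_min ltr01 andbT addr_gt0 ?sdim_gt0.
have s1 i : (b ^+ i) `^ (sdim a + sdim b) <= 1.
  rewrite -[leRHS](powRr0 (b ^+ i)); apply: ger_powR; rewrite ?exprn_gt0//=.
  by rewrite addr_ge0 ?ltW ?sdim_gt0.
rewrite avg_fdiff.
have E1 (i : 'I_M) : 2^-1 ^+ i.+1 * G i <= (2 * T + 1)%:R *
    (8 * C' * k%:R * (a ^+ L) `^ D + (Q i)%:R).
  rewrite exprS /G /W ltn_ord.
  have -> : 2^-1 * 2^-1 ^+ i * ((2 * T + 1)%:R * (2 * (b ^+ i) `^ sdim a) *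
      (8 * l i * k%:R + (Q i)%:R)) = (2 * T + 1)%:R *
     (2^-1 ^+ i * (b ^+ i) `^ sdim a * (8 * l i * k%:R + (Q i)%:R)) by field.
  rewrite ler_wpM2l// sE mulrDr lerD// ?ler_piMl//.
  have -> : (b ^+ i) `^ (sdim a + sdim b) * (8 * l i * k%:R) =
     8 * C' * k%:R * ((b ^+ i) `^ (sdim a + sdim b) / b ^+ i * a ^+ L).
    by rewrite /l; ring.
  apply: ler_wpM2l.
    by apply: mulr_ge0 => //; apply: mulr_ge0 => //; exact: ltW.
  apply: powR_min_le => //; rewrite aL /=.
  apply: (le_trans (le_expn_digits a01 b01 L)).
  by apply: ler_wiXn2l; [exact: ltW|exact: ltW|exact: ltnW].
have E2 : 2^-1 ^+ M * G M <= (2 * T + 1)%:R * (2 / b * (a ^+ L) `^ D * k%:R).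
  rewrite /G /W ltnn.
  have rE (x y c z : R) : y * (c * (2 * x) * z) = c * (2 * (y * x) * z) by ring.
  rewrite rE.
  rewrite sE ler_wpM2l// ler_wpM2r// -mulrA ler_wpM2l//.
  apply: (@le_trans _ _ ((b ^+ M) `^ D)).
    by apply: ger_powR => //; rewrite exprn_gt0 ?bi1.
  (* Since D <= 1, b is at most b^D, which supplies the missing digit: b^(M+1) < a^L. *)
  rewrite ler_pdivlMl//; apply: (@le_trans _ _ (b `^ D * (b ^+ M) `^ D)).
    rewrite ler_wpM2r ?powR_ge0//; apply: ger1_powR => //.
    by rewrite b0 /= ltW.
  rewrite -powRM ?exprn_ge0 ?(ltW b0)//.
  apply: ge0_ler_powR;
    rewrite ?nnegrE ?mulr_ge0 ?exprn_ge0 ?(ltW a0) ?(ltW b0)//.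
    exact: ltW.
  by rewrite mulrC; exact/ltW/expn_digits_lt.
apply: (le_trans (lerD (ler_sum _ (fun i _ => E1 i)) E2)).
rewrite -mulr_sumr big_split /= sumr_const card_ord.
set X := (a ^+ L) `^ D; rewrite -[_ *+ M]mulr_natr.
have ML : M%:R <= L.+1%:R * th.
  have /andP[+ _] := digits_itv a01 b01 L; rewrite -/th -/M => /le_trans; apply.
  by apply: ler_wpM2r; [exact: ltW|rewrite ler_nat].
have X0 : 0 <= X by exact: powR_ge0.
have L1 : 1 <= L.+1%:R :> R by rewrite ler1n.
have h1 : 8 * C' * k%:R * X * M%:R <= 8 * C' * k%:R * X * (L.+1%:R * th).
  apply: ler_wpM2l => //; apply: mulr_ge0 => //; apply: mulr_ge0 => //.
  by apply: mulr_ge0 => //; exact: ltW.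
have h2 : 2 / b * X * k%:R <= 2 / b * X * k%:R * L.+1%:R.
  rewrite -[leLHS]mulr1.
  apply: ler_wpM2l => //; apply: mulr_ge0 => //; apply: mulr_ge0 => //.
  by apply: divr_ge0 => //; exact: ltW.
have rE (t c u v x y z S : R) : t * (8 * c * u + v) * x * y * z + t * S =
  t * (8 * c * z * y * (x * u) + v * y * z * x) + t * S by ring.
have rE' (t A S B : R) : t * (A + S) + t * B = t * (A + B) + t * S by ring.
rewrite rE' rE lerD2r; apply: ler_wpM2l => //; exact: lerD.
Qed.

End Decay.

End Digits.

(** * Iterating the one-step bound *)

Section Decay.
Context {R : realType}.

Lemma pcoll_le1 (a b lambda : R) n m r : pcoll a b lambda n m r <= 1.
Proof.
rewrite -[leRHS](avg_wpairs_cst n m); apply: le_avg => p _.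
rewrite -[leRHS](avg_wpairs_cst n m); apply: le_avg => q _.
by rewrite -[1]/(1%:R) ler_nat leq_b1.
Qed.

Lemma le_pcoll (a b lambda : R) n m r r' : r <= r' ->
  pcoll a b lambda n m r <= pcoll a b lambda n m r'.
Proof. by move=> rr'; apply: le_coll => p q _ _ /le_trans; apply. Qed.

(** The square of exp(tL/2) is at least (tL/2)^2, which exceeds 2CL as soon as L > 8C/t^2. *)
Lemma linear_le_expR (C t : R) : 0 < C -> 0 < t ->
  exists2 L, (0 < L)%N & C * L.+1%:R <= expR (t * L%:R).
Proof.
move=> C0 t0; pose L := (Num.truncn (8 * C / t ^+ 2)).+1.
exists L => //.
have t2 : 0 < t ^+ 2 by rewrite exprn_gt0.
have L1 : 1 <= L%:R :> R by rewrite ler1n.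
have : 8 * C / t ^+ 2 < L%:R by exact: truncnS_gt.
rewrite ltr_pdivrMr// => LC; clearbody L.
have -> : t * L%:R = 2%:R * (t * L%:R / 2) by field.
rewrite expRM_natl.
have h : t * L%:R / 2 <= expR (t * L%:R / 2).
  by apply: le_trans (expR_ge1Dx _); rewrite lerDr.
apply: (@le_trans _ _ ((t * L%:R / 2) ^+ 2)); last first.
  by rewrite ler_pXn2r ?nnegrE ?expR_ge0// divr_ge0// mulr_ge0// ltW.
have : 8 * C * L%:R <= L%:R * t ^+ 2 * L%:R by rewrite ler_wpM2r// ltW.
have : C * 1 <= C * L%:R by rewrite ler_pM2l.
have -> : (t * L%:R / 2) ^+ 2 = L%:R * t ^+ 2 * L%:R / 4 by field.
by rewrite -[L.+1%:R]natr1 mulrDr; lra.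
Qed.

Variables (a b lambda : R).
Hypotheses (ha : 0 < a < 2^-1) (hb : 0 < b < 2^-1).

Let a01 := lt01_of ha.
Let b01 := lt01_of hb.
Let a0 : 0 < a. Proof. by case/andP: ha. Qed.
Let b0 : 0 < b. Proof. by case/andP: hb. Qed.
Local Notation K := (1 + `|lambda| / b / b).
Local Notation D := (Num.min (sdim a + sdim b) 1).

(** [pcoll_submult] at r = a^L, followed by [pcoll_truncate] to drop the excess digits. The constant
    is uniform in [n] because the relative scales are bounded. *)
Lemma pcoll_step : exists2 C : R, 0 < C & forall n L,
  pcoll a b lambda (n + L) (digits a b (n + L)) (a ^+ (n + L)) <=
  C * pcoll a b lambda n (digits a b n) (a ^+ n) *
    pcoll a b (relscale a b lambda n) L (digits a b L) (K * a ^+ L).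
Proof.
pose T := (Num.truncn (2 + `|lambda| / b)).+1.
have TL : 2 + `|lambda| / b <= T%:R by apply/ltW/truncnS_gt.
exists (3 * (2 * T + 1))%:R => [|n L]; first by rewrite ltr0n; lia.
rewrite exprD digits_add//; set e := (digits a b (n + L) - _ - _)%N.
have aL : 0 < a ^+ L <= 1.
  by rewrite exprn_gt0//= exprn_ile1 ?ltW//; case/andP: a01.
have rl := relscale_le lambda ha hb n.
apply: (le_trans (pcoll_submult (T := T) _ _ a01 b01 aL _)).
  by apply: le_trans TL; rewrite lerD2l.
apply: ler_wpM2l; first by apply: mulr_ge0; [exact: ler0n|exact: coll_ge0].
apply: (le_trans (pcoll_truncate _ _ _ _ _ a01 b01)).
apply: le_pcoll; rewrite mulrDl mul1r lerD2l -/(relscale a b lambda n).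
apply: (@le_trans _ _ (`|lambda| / b * b ^+ digits a b L)).
  by rewrite ler_wpM2r// exprn_ge0// ltW.
rewrite -[leRHS]mulrA ler_wpM2l ?divr_ge0// ?(ltW b0)//.
by rewrite mulrC ler_pdivlMr// ltW// expn_digits_lt.
Qed.

Hypothesis l0 : lambda != 0.
Hypothesis irr : irrational (ln b / ln a).

Theorem pcoll_decay (e : R) : 0 < e ->
  exists2 L, (0 < L)%N & exists k0, forall k, (k0 <= k)%N ->
  pcoll a b lambda (k * L) (digits a b (k * L)) (a ^+ (k * L)) <=
  (a ^+ (k * L)) `^ (D - e).
Proof.
move=> e0; have [C1 C10 step] := pcoll_step.
have [C2 C20 sumle] := sum_pcoll_le ha hb l0 irr.
have la := ln_lt0_of a01.
have C0 : 0 < 2 * C1 * C2 by rewrite !mulr_gt0.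
have t0 : 0 < e * - ln a by rewrite mulr_gt0// oppr_gt0.
have [L L0 CL] := linear_le_expR C0 t0.
exists L => //; have [Q QP] := sumle _ L0.
have aL : 0 < a ^+ L by exact: exprn_gt0.
pose eta := C2 * L.+1%:R * (a ^+ L) `^ D.
have eta0 : 0 < eta by rewrite !mulr_gt0// powR_gt0.
have etaL : C1 * (2 * eta) <= (a ^+ L) `^ (D - e).
  have -> : (a ^+ L) `^ (D - e) = expR (e * - ln a * L%:R) * (a ^+ L) `^ D.
    rewrite !powRE// -expRD expnE// expRK; congr expR; ring.
  have -> : C1 * (2 * eta) = 2 * C1 * C2 * L.+1%:R * (a ^+ L) `^ D.
    by rewrite /eta; ring.
  by rewrite ler_wpM2r// powR_ge0.
pose g j :=
  pcoll a b (relscale a b lambda (j * L)) L (digits a b L) (K * a ^+ L).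
have g0 j : 0 <= g j by exact: coll_ge0.
have prodle k : pcoll a b lambda (k * L) (digits a b (k * L)) (a ^+ (k * L)) <=
    \prod_(j < k) (C1 * g j).
  elim: k => [|k IH]; first by rewrite big_ord0 pcoll_le1.
  rewrite mulSn addnC big_ord_recr/=; apply: (le_trans (step _ _)).
  rewrite -mulrA mulrCA ler_wpM2r//.
  exact: mulr_ge0 (ltW C10) (g0 _).
(* From this rank on, [Q] is at most [eta * k], so it costs at most the factor 2 reserved in
   [etaL]. *)
exists (Num.truncn (`|Q| / eta)).+1 => k kk.
have Qk : `|Q| <= eta * k%:R.
  rewrite mulrC -ler_pdivrMr//; apply: (le_trans (ltW (truncnS_gt _))).
  by rewrite ler_nat.
have k0 : 0 < k%:R :> R by rewrite ltr0n; apply: leq_trans kk.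
apply: (le_trans (prodle k)).
have := @leif_AGM R 'I_k predT (fun j => C1 * g j) _.
move=> /(_ _)[]; first by move=> j _; exact: mulr_ge0 (ltW C10) (g0 _).
rewrite /= card_ord => /le_trans + _; apply.
have -> : (a ^+ (k * L)) `^ (D - e) = ((a ^+ L) `^ (D - e)) ^+ k.
  by rewrite mulnC exprM powR_expn.
apply: lerXn2r; rewrite ?nnegrE ?powR_ge0//.
  by apply: divr_ge0 => //; apply: sumr_ge0 => j _;
    exact: mulr_ge0 (ltW C10) (g0 _).
apply: le_trans etaL; rewrite -mulr_sumr -mulrA ler_wpM2l ?(ltW C10)//.
rewrite ler_pdivrMr//; apply: (le_trans (QP k)).
by have := ler_norm Q; rewrite -/eta; lra.
Qed.

End Decay.

(** * Hausdorff and packing dimensions *)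

Section Dimensions.
Context {R : realType}.
Implicit Types (s t delta r x : R) (E F U : set R).

Lemma diameter_ge0 U : (0 <= diameter U)%E.
Proof. by apply: ereal_sup_ubound; left. Qed.

Lemma diameter_le U delta : 0 <= delta ->
  (forall x y, U x -> U y -> `|x - y| <= delta) -> (diameter U <= delta%:E)%E.
Proof.
move=> d0 Ud; apply: ge_ereal_sup => _ [->|[[x y] [/= Ux Uy] <-]].
  by rewrite lee_fin.
by rewrite lee_fin Ud.
Qed.

Lemma diameter_set0 : diameter (@set0 R) = 0%E.
Proof. by apply/eqP; rewrite eq_le diameter_ge0 andbT diameter_le. Qed.

Lemma diam_pow_ge0 s U : (0 <= diam_pow s U)%E.
Proof. by rewrite /diam_pow; case: ifP => // _; exact: poweR_ge0. Qed.

Lemma diam_pow_le s U delta : 0 <= s -> (diameter U <= delta%:E)%E ->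
  (diam_pow s U <= (delta `^ s)%:E)%E.
Proof.
move=> s0 Ud; rewrite /diam_pow; case: ifP => _; first
  by rewrite lee_fin powR_ge0.
rewrite -poweR_EFin gt0_ler_poweR// in_itv/= ?andbT ?leey ?diameter_ge0//.
by rewrite (le_trans (diameter_ge0 U)).
Qed.

Lemma hausdorff_premeasure_ge0 s delta E :
  (0 <= hausdorff_premeasure s delta E)%E.
Proof.
by apply: le_ereal_inf_tmp => _ [U _ <-]; apply: nneseries_ge0 => i _ _;
  exact: diam_pow_ge0.
Qed.

Lemma le_hausdorff_premeasure s delta delta' E : delta <= delta' ->
  (hausdorff_premeasure s delta' E <= hausdorff_premeasure s delta E)%E.
Proof.
move=> dd'; apply: ereal_inf_le_tmp => _ [U [EU Ud] <-]; exists U => //.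
by split=> // i; apply: (le_trans (Ud i)); rewrite lee_fin.
Qed.

Lemma finite_cover_premeasure s delta E (N : nat) (U : nat -> set R) :
  0 <= s -> 0 <= delta ->
  E `<=` \bigcup_(i < N) U i ->
  (forall i, (diameter (U i) <= delta%:E)%E) ->
  (hausdorff_premeasure s delta E <= (N%:R * delta `^ s)%:E)%E.
Proof.
(* Padding with empty sets is free: [diam_pow] gives them weight 0 even for s = 0. *)
move=> s0 d0 EU Ud; pose V i := if (i < N)%N then U i else set0.
have Vd i : (diameter (V i) <= delta%:E)%E.
  by rewrite /V; case: ifP => // _; rewrite diameter_set0 lee_fin.
apply: (@le_trans _ _ (\sum_(0 <= i <oo) diam_pow s (V i))%E).
  apply: ereal_inf_lbound; exists V => //; split => //.
  by move=> x /EU[i /= iN Uix]; exists i => //; rewrite /V iN.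
rewrite (@nneseries_split _ _ 0 N); last by move=> *; exact: diam_pow_ge0.
rewrite add0n [X in (_ + X)%E]eseries0 ?adde0; last first.
  by move=> i Ni _; rewrite /V ltnNge Ni /= /diam_pow eqxx.
apply: (@le_trans _ _ (\sum_(0 <= i < N) (delta `^ s)%:E)%E).
  by apply: lee_sum => i _; exact: diam_pow_le.
by rewrite sumEFin sumr_const_nat subn0 mulr_natl.
Qed.

Lemma packing_premeasure_at_ge0 s delta E :
  (0 <= packing_premeasure_at s delta E)%E.
Proof.
apply: ereal_sup_ubound; exists set0, (fun=> 0), (fun=> 0); split.
  by split => // i j [].
by rewrite /packing_value esum_set0.
Qed.

Lemma packing_premeasure_ge0 s E : (0 <= packing_premeasure s E)%E.
Proof. by apply: le_ereal_inf_tmp => _ [d _ <-];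
  exact: packing_premeasure_at_ge0. Qed.

Lemma le_packing_premeasure_at s delta delta' E : delta <= delta' ->
  (packing_premeasure_at s delta E <= packing_premeasure_at s delta' E)%E.
Proof.
move=> dd'; apply: ereal_sup_le => _ [D [x [r [[Er tr] ->]]]].
exists D, x, r; split => //; split => // i /Er[Ex /andP[r0 rd]].
by split => //; rewrite r0 (le_trans rd).
Qed.

(** The inequality is strict so that closed balls of radius [delta] around the points are
    disjoint. *)
Definition separated delta E (N : nat) := exists x : nat -> R,
  (forall i, (i < N)%N -> E (x i)) /\
  (forall i j, (i < N)%N -> (j < N)%N -> i != j -> 2 * delta < `|x i - x j|).

Lemma separated_le s delta E N : 0 < delta -> separated delta E N ->
  ((N%:R * (2 * delta) `^ s)%:E <= packing_premeasure_at s delta E)%E.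
Proof.
move=> d0 [x [Ex sep]].
apply: ereal_sup_ubound; exists `I_N, x, (fun=> delta); split; last first.
  rewrite /packing_value esum_fset//; last first.
    by move=> i _; rewrite lee_fin powR_ge0.
  by rewrite -(fsbig_ord _ _ (fun=> ((2 * delta) `^ s)%:E)) sumEFin sumr_const card_ord mulr_natl.
split => [i iN|]; first by rewrite lexx d0; split => //; exact: Ex.
apply/trivIsetP => i j /= iN jN ij; rewrite -subset0 => y [].
rewrite !closed_ball_itv//= !in_itv/= => /andP[y1 y2] /andP[y3 y4].
have := sep _ _ iN jN ij; rewrite ltNge => /negP; apply.
by rewrite ler_norml; lra.
Qed.

(** A finite packing premeasure bounds the size of separated families, so a maximal one exists. Its
    balls of radius delta form a packing, and by maximality those of radius 2 delta cover E. Their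
    diameters are at most 4 delta = 2 (2 delta), whence 2^s. *)
Lemma hausdorff_le_packing_at s delta E : 0 <= s -> 0 < delta ->
  (hausdorff_premeasure s (4 * delta) E <=
   (2 `^ s)%:E * packing_premeasure_at s delta E)%E.
Proof.
move=> s0 d0; have [Poo|] := eqVneq (packing_premeasure_at s delta E) +oo%E.
  by rewrite Poo gt0_muley ?leey// lte_fin powR_gt0.
rewrite -ltey => Pfin; have P0 := packing_premeasure_at_ge0 s delta E.
have : packing_premeasure_at s delta E \is a fin_num by rewrite ge0_fin_numE.
move=> /fineK PE; set p := fine _ in PE.
have d2 : 0 < (2 * delta) `^ s by rewrite powR_gt0// mulr_gt0.
have sepN : exists N, `[< separated delta E N >].
  by exists 0; apply/asboolP; exists (fun=> 0).
have bnd N : `[< separated delta E N >] ->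
    (N <= Num.truncn (p / (2 * delta) `^ s))%N.
  move=> /asboolP /(separated_le s d0); rewrite -PE lee_fin -ler_pdivlMr// =>
    le.
  by rewrite truncn_ge_nat// (le_trans _ le).
have [N /asboolP sN Nmax] := ex_maxnP sepN bnd.
have [x [Ex sep]] := sN.
apply: (@le_trans _ _ (N%:R * (4 * delta) `^ s)%:E).
  apply: (@finite_cover_premeasure _ _ _ _
    (fun i => [set y | `|y - x i| <= 2 * delta])) => //.
  - by rewrite mulr_ge0// ltW.
  - move=> y Ey; apply: contrapT => ncov.
    suff /asboolP/Nmax : separated delta E N.+1 by rewrite ltnn.
    exists (fun i => if (i < N)%N then x i else y).
    have far i : (i < N)%N -> 2 * delta < `|y - x i|.
      by move=> iN; rewrite ltNge; apply/negP => le; apply: ncov; exists i.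
    split=> [i _|i j]; first by case: ifP => // /Ex.
    rewrite !ltnS => iN jN ij; case: ifP => iN'; case: ifP => jN'.
    + exact: sep.
    + by rewrite distrC far.
    + exact: far.
    + move: ij; suff -> : i = j by rewrite eqxx.
      by move: iN jN iN' jN'; clear; lia.
  - move=> i; apply: diameter_le; first by rewrite mulr_ge0// ltW.
    by move=> y z /=; rewrite !ler_norml; lra.
rewrite -PE -EFinM lee_fin.
have := separated_le s d0 sN; rewrite -PE lee_fin => Np.
have -> : 4 * delta = 2 * (2 * delta) by ring.
have dd0 : 0 <= 2 * delta by lra.
by rewrite powRM// mulrCA ler_wpM2l// powR_ge0.
Qed.

Lemma hausdorff_le_packing s delta E : 0 <= s -> 0 < delta ->
  (hausdorff_premeasure s delta E <= (2 `^ s)%:E * packing_premeasure s E)%E.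
Proof.
move=> s0 d0; have c0 : 0 < 2 `^ s by rewrite powR_gt0.
rewrite -lee_pdivrMl//; apply: le_ereal_inf_tmp => _ [d /= dp <-].
rewrite lee_pdivrMl//.
pose d' := Num.min d (delta / 4).
have d'0 : 0 < d' by rewrite lt_min dp divr_gt0.
apply: le_trans (lee_wpmul2l _ (@le_packing_premeasure_at s d' d E _)).
- apply: le_trans (hausdorff_le_packing_at E s0 d'0).
  apply: le_hausdorff_premeasure; rewrite mulrC -ler_pdivlMr//.
  by rewrite ge_min lexx orbT.
- by rewrite lee_fin ltW.
- by rewrite ge_min lexx.
Qed.

End Dimensions.

(** * Mass distribution principle and its converse *)

Section MassDistribution.
Context {R : realType}.
Implicit Types (s t delta r x : R) (E F U V A K : set R).

Lemma measurable_closed_ball x r : measurable (closed_ball x r).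
Proof.
have [r0|r0] := ltP 0 r; first by rewrite closed_ball_itv.
by rewrite closed_ball0.
Qed.

Lemma geometric_scale (rho r : R) : 0 < rho < 1 -> 0 < r <= 1 ->
  exists n, rho ^+ n.+1 < r <= rho ^+ n.
Proof.
move=> rho01 /andP[r0 r1]; have lr := ln_lt0_of rho01.
have rho0 : 0 < rho by case/andP: rho01.
have lr0 : ln r <= 0 by apply: ln_le0.
have q0 : 0 <= ln r / ln rho by rewrite -mulrNN -invrN divr_ge0 ?oppr_ge0// ltW.
exists (Num.truncn (ln r / ln rho)); rewrite !expnE//.
have /andP[] := truncn_itv q0.
rewrite ler_ndivlMr// ltr_ndivrMr// => h1 h2.
by rewrite -{2 3}[r]lnK// ltr_expR ler_expR h1 h2.
Qed.

Lemma exists_powR_le t (e : R) : 0 < t -> 0 < e ->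
  exists2 d, 0 < d <= 1 & d `^ t <= e.
Proof.
move=> t0 e0; pose d := Num.min 1 (e `^ t^-1).
have et : 0 < e `^ t^-1 by rewrite powR_gt0.
exists d; first by rewrite lt_min ltr01 et ge_min lexx.
apply: (@le_trans _ _ ((e `^ t^-1) `^ t)); last first.
  by rewrite -powRrM mulVf ?gt_eqF// powRr1// ltW.
apply: ge0_ler_powR; rewrite ?nnegrE ?(ltW t0) ?(ltW et)//.
  by rewrite le_min ler01 ltW.
by rewrite ge_min lexx orbT.
Qed.

Section Packing.
Variables (mu : {measure set R -> \bar R}) (K E : set R) (c t : R).
Hypotheses (mK : measurable K) (Kfin : (mu K < +oo)%E) (c0 : 0 < c).
Hypothesis lower : forall x r, E x -> 0 < r <= 1 ->
  closed_ball x r `<=` K /\ ((c * r `^ t)%:E <= mu (closed_ball x r))%E.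

(** The balls of a packing are disjoint subsets of [K], so their masses, each at least c r^t, sum to
    at most that of [K]; the spare power r^(s-t) is at most delta^(s-t). *)
Lemma packing_premeasure_at_le s delta : t < s -> 0 < delta <= 1 ->
  (packing_premeasure_at s delta E <=
   (2 `^ s * delta `^ (s - t) / c)%:E * mu K)%E.
Proof.
move=> ts /andP[d0 d1]; set k := 2 `^ s * _ / c.
have k0 : 0 <= k by rewrite divr_ge0 ?ltW// mulr_gt0 ?powR_gt0.
apply: ge_ereal_sup => _ [D [x [r [[Er tr] ->]]]].
apply: ge_ereal_sup => _ [J [finJ JD] <-].
have mB i : J i -> measurable (closed_ball (x i) (r i)).
  by move=> _; exact: measurable_closed_ball.
apply: (@le_trans _ _ (\sum_(i \in J) (k%:E * mu (closed_ball (x i) (r i))))%E).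
  apply: lee_fsum => // i /JD/Er[Ex /andP[ri0 rid]].
  have [_ low] := lower Ex (introT andP (conj ri0 (le_trans rid d1))).
  apply: le_trans (lee_wpmul2l _ low); last by rewrite lee_fin.
  rewrite lee_fin mulrA mulfVK ?gt_eqF// powRM ?(ltW ri0)// -mulrA ler_wpM2l ?powR_ge0//.
  have -> : r i `^ s = r i `^ (s - t) * r i `^ t.
    by rewrite -powRD ?subrK// (gt_eqF ri0) implybT.
  rewrite ler_wpM2r ?powR_ge0//; apply: ge0_ler_powR;
    rewrite ?nnegrE ?(ltW ri0) ?(ltW d0)//.
  by rewrite subr_ge0 ltW.
rewrite -ge0_mule_fsumr; last by move=> i; exact: measure_ge0.
apply: lee_wpmul2l; first by rewrite lee_fin.
rewrite -measure_fin_bigcup//; last exact: sub_trivIset tr.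
apply: le_measure; rewrite ?inE//; first exact: fin_bigcup_measurable.
move=> y [i /JD/Er[Ex /andP[ri0 rid]]].
by have [+ _] := lower Ex (introT andP (conj ri0 (le_trans rid d1))); apply.
Qed.

Lemma packing_premeasure_eq0 s : t < s -> packing_premeasure s E = 0%E.
Proof.
move=> ts; apply/eqP; rewrite eq_le packing_premeasure_ge0 andbT.
apply/lee_addgt0Pr => e e0; rewrite add0e.
have : mu K \is a fin_num by rewrite ge0_fin_numE.
move=> /fineK KE; set M := fine _ in KE.
have M0 : 0 <= M by rewrite fine_ge0.
have st0 : 0 < s - t by rewrite subr_gt0.
pose k := 2 `^ s / c * (M + 1).
have k0 : 0 < k by rewrite mulr_gt0 ?divr_gt0 ?powR_gt0// ltr_wpDl.
have [d d01 de] := exists_powR_le st0 (divr_gt0 e0 k0).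
apply: (@le_trans _ _ (packing_premeasure_at s d E)).
  by apply: ereal_inf_lbound; exists d => //=; case/andP: d01.
apply: (le_trans (packing_premeasure_at_le ts d01)).
rewrite -KE -EFinM lee_fin.
move: de; rewrite ler_pdivlMr// => de; apply: le_trans de.
have -> : 2 `^ s * d `^ (s - t) / c * M = d `^ (s - t) * (2 `^ s / c * M)
  by ring.
rewrite ler_wpM2l ?powR_ge0// ler_wpM2l ?lerDl ?ler01//.
by rewrite divr_ge0 ?powR_ge0// ltW.
Qed.

Lemma packing_dim_le : 0 <= t -> (packing_dim E <= t%:E)%E.
Proof.
move=> t0; apply/lee_addgt0Pr => e e0; apply: ereal_inf_lbound;
  exists (t + e) => //=.
split; first by rewrite addr_ge0// ltW.
apply/eqP; rewrite eq_le; apply/andP; split; last first.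
  apply: le_ereal_inf_tmp => _ [G _ <-]; apply: nneseries_ge0 => i _ _.
  exact: packing_premeasure_ge0.
apply: ereal_inf_lbound; exists (fun=> E); first by move=> x Ex; exists 0.
by rewrite eseries0// => i _ _; rewrite packing_premeasure_eq0// ltrDl.
Qed.

Lemma hausdorff_dim_le : 0 <= t -> (hausdorff_dim E <= t%:E)%E.
Proof.
move=> t0; apply/lee_addgt0Pr => e e0; apply: ereal_inf_lbound;
  exists (t + e) => //=.
have te : 0 <= t + e by rewrite addr_ge0// ltW.
split => //; apply/eqP; rewrite eq_le; apply/andP; split.
  apply: ge_ereal_sup => _ [d /= d0 <-].
  apply: (le_trans (hausdorff_le_packing _ te d0)).
  by rewrite packing_premeasure_eq0 ?mule0// ltrDl.
apply: (le_trans (hausdorff_premeasure_ge0 (t + e) 1 E)).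
by apply: ereal_sup_ubound; exists 1 => //=.
Qed.

Lemma packing_hausdorff_dim_le : 0 <= t ->
  (packing_dim E <= t%:E)%E /\ (hausdorff_dim E <= t%:E)%E.
Proof. by move=> t0; split;
  [exact: packing_dim_le|exact: hausdorff_dim_le]. Qed.

End Packing.

Section Content.
Variables (mu : {measure set R -> \bar R}) (A : set R) (C r0 s : R).
Hypotheses (C0 : 0 < C) (r0_gt0 : 0 < r0) (s0 : 0 <= s).
Hypothesis upper : forall x r, A x -> 0 <= r < r0 ->
  (mu `[(x - r)%R, (x + r)%R]%classic <= (C * r `^ s)%:E)%E.

Lemma content_cover F delta (e : R) : delta < r0 -> 0 < e ->
  exists V, [/\ measurable V, A `&` F `<=` V &
    (mu V <= C%:E * (hausdorff_premeasure s delta F + e%:E))%E].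
Proof.
move=> dr e0; have [Hoo|] := eqVneq (hausdorff_premeasure s delta F) +oo%E.
  by exists setT; split => //; rewrite Hoo addye// gt0_muley ?lte_fin// leey.
rewrite -ltey => Hfin.
have Hfn : hausdorff_premeasure s delta F \is a fin_num.
  by rewrite ge0_fin_numE// hausdorff_premeasure_ge0.
have [_ [U [FU Ud] <-] Ule] := lb_ereal_inf_adherent e0 Hfn.
have cover i : exists V, [/\ measurable V, A `&` U i `<=` V &
    (mu V <= C%:E * diam_pow s (U i))%E].
  have [[x [Ax Ux]]|none] := pselect (exists x, A x /\ U i x); last first.
    exists set0; split => //; first by move=> x [Ax Ux]; case: none; exists x.
    by rewrite measure0 mule_ge0 ?lee_fin ?(ltW C0)// diam_pow_ge0.
  have Dfn : diameter (U i) \is a fin_num.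
    by rewrite ge0_fin_numE ?diameter_ge0// (le_lt_trans (Ud i)) ?ltry.
  have DE := fineK Dfn; set r := fine _ in DE.
  have r_ge0 : 0 <= r by rewrite fine_ge0// diameter_ge0.
  have rd : r <= delta by rewrite -lee_fin DE.
  exists `[x - r, x + r]%classic; split => //.
    move=> y [_ Uy] /=; rewrite in_itv/=.
    suff : `|x - y| <= r by rewrite ler_norml; lra.
    by rewrite -lee_fin DE; apply: ereal_sup_ubound; right; exists (x, y).
  have -> : diam_pow s (U i) = (r `^ s)%:E.
    rewrite /diam_pow -DE; case: eqP => // U0.
    by move: Ux; rewrite U0.
  by rewrite -EFinM; apply: upper => //; rewrite r_ge0 (le_lt_trans rd).
have [V VP] := choice cover.
exists (\bigcup_i V i); split.
- by apply: bigcup_measurable => i _; have [] := VP i.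
- move=> x [Ax /FU[i _ Uix]]; exists i => //.
  by have [_ + _] := VP i; apply.
apply: (le_trans (le_mu_bigcup _ _ _)).
- by move=> i; have [] := VP i.
- by apply: bigcup_measurable => i _; have [] := VP i.
apply: (@le_trans _ _ (\sum_(0 <= i <oo) (C%:E * diam_pow s (U i)))%E).
  by apply: lee_nneseries => [i _ _|i _]; [exact: measure_ge0|have [] := VP i].
rewrite nneseriesZl; last by move=> i _; exact: diam_pow_ge0.
by apply: lee_wpmul2l; [rewrite lee_fin ltW|exact: ltW].
Qed.

Variables (E : set R) (m : R).
Hypothesis m0 : 0 < m.
Hypothesis full : forall V, measurable V -> A `&` E `<=` V -> (m%:E <= mu V)%E.

(** Mass distribution principle: a cover of small weight would capture mass at most m/2. Hypothesis
    [full] says that [A] and [E] meet in a set of outer measure at least m, so the result applies to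
    sets not shown to be measurable, such as [cantor_set]. *)
Lemma hausdorff_measure_neq0 : hausdorff_measure s E <> 0%E.
Proof.
move=> H0; have e0 : 0 < m / (2 * C) by rewrite divr_gt0// mulr_gt0.
have d0 : r0 / 2 < r0 by rewrite ltr_pdivrMr// ltr_pMr// ltr1n.
have [V [mV /(full mV) mu_ge]] := content_cover E d0 e0.
apply/negP; rewrite -ltNge; apply: lt_le_trans mu_ge.
have -> : hausdorff_premeasure s (r0 / 2) E = 0%E.
  apply/eqP; rewrite eq_le hausdorff_premeasure_ge0 andbT -H0.
  by apply: ereal_sup_ubound; exists (r0 / 2) => //=; rewrite divr_gt0.
rewrite add0e -EFinM lte_fin.
have -> : C * (m / (2 * C)) = m / 2 by field; rewrite gt_eqF.
by rewrite ltr_pdivrMr// ltr_pMr// ltr1n.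
Qed.

(** Each piece of a cover of small total packing premeasure has small Hausdorff premeasure by
    [hausdorff_le_packing], so [content_cover] applies piece by piece. The pieces contribute less
    than m/8 and the errors m/4, in total less than m. *)
Lemma packing_measure_neq0 : packing_measure s E <> 0%E.
Proof.
move=> P0; pose e := m / (8 * C * 2 `^ s).
have p0 : 0 < 2 `^ s by rewrite powR_gt0.
have e0 : 0 < e by rewrite divr_gt0// !mulr_gt0.
have [] :=
  @lb_ereal_inf_adherent R _ e e0 (_ : packing_measure s E \is a fin_num).
  by rewrite P0.
rewrite -/(packing_measure s E) P0 add0e => _ [F EF <-] Fe.
have d0 : 0 < r0 / 2 by rewrite divr_gt0.
have dr : r0 / 2 < r0 by rewrite ltr_pdivrMr// ltr_pMr// ltr1n.
have p2 i : 0 < m / (4 * C) / (2 ^ i.+1)%:R.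
  by rewrite !divr_gt0 ?mulr_gt0// ltr0n expn_gt0.
have [V VP] := choice (fun i => content_cover (F i) dr (p2 i)).
have mV : measurable (\bigcup_i V i).
  by apply: bigcup_measurable => i _; have [] := VP i.
have : A `&` E `<=` \bigcup_i V i.
  move=> x [Ax /EF[i _ Fx]]; exists i => //.
  by have [_ + _] := VP i; apply.
move=> /(full mV); apply/negP; rewrite -ltNge.
apply: (le_lt_trans (le_mu_bigcup _ _ mV)).
  by move=> i; have [] := VP i.
apply: (@le_lt_trans _ _ (\sum_(0 <= i <oo)
   (C%:E * ((2 `^ s)%:E * packing_premeasure s (F i) +
      (m / (4 * C) / (2 ^ i.+1)%:R)%:E)))%E).
  apply: lee_nneseries => [i _ _|i _]; first exact: measure_ge0.
  have [_ _ /le_trans] := VP i; apply.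
  apply: lee_wpmul2l; first by rewrite lee_fin ltW.
  by rewrite leeD2r// hausdorff_le_packing.
have pp i : (0 <= (2 `^ s)%:E * packing_premeasure s (F i))%E.
  by rewrite mule_ge0 ?packing_premeasure_ge0// lee_fin ltW.
rewrite nneseriesZl; last first.
  by move=> i _; rewrite adde_ge0// lee_fin ltW.
apply: (@le_lt_trans _ _ (C%:E * (\sum_(0 <= i <oo)
    ((2 `^ s)%:E * packing_premeasure s (F i)) + (m / (4 * C))%:E))%E).
  apply: lee_wpmul2l; first by rewrite lee_fin ltW.
  by apply: epsilon_trick => //; rewrite divr_ge0 ?mulr_ge0 ?ltW.
rewrite nneseriesZl; last by move=> i _; exact: packing_premeasure_ge0.
apply: (@le_lt_trans _ _ (C%:E * ((2 `^ s)%:E * e%:E + (m / (4 * C))%:E))%E).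
  apply: lee_wpmul2l; first by rewrite lee_fin ltW.
  by apply: leeD2r; apply: lee_wpmul2l; [rewrite lee_fin ltW|exact: ltW].
rewrite (_ : (_ * _)%E = (C * (2 `^ s * e + m / (4 * C)))%:E)// lte_fin /e.
have -> : C * (2 `^ s * (m / (8 * C * 2 `^ s)) + m / (4 * C)) = m * (3 / 8).
  by field; rewrite !gt_eqF.
by rewrite gtr_pMr//; lra.
Qed.

End Content.

End MassDistribution.

(** * Correlation integrals *)

Section Correlation.
Context {R : realType}.
Variable nu : probability R R.
Implicit Types (s r x : R).

Lemma measurable_near (r : R) : measurable [set z : R * R | `|z.1 - z.2| <= r].
Proof.
have mf : measurable_fun setT (fun z : R * R => `|z.1 - z.2|).
  apply: measurableT_comp => //; apply: measurable_funB.
    exact: measurable_fst.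
  exact: measurable_snd.
rewrite (_ : [set _ | _] = setT `&` (fun z : R * R =>
  `|z.1 - z.2|) @^-1` `]-oo, r]).
  exact: mf.
by rewrite setTI; apply/seteqP; split => z /=; rewrite in_itv.
Qed.

Lemma closed_ball_norm (x r : R) : 0 < r ->
  closed_ball x r = [set y | `|x - y| <= r].
Proof. by move=> r0; rewrite closed_ballE. Qed.

Lemma measurable_measure_closed_ball r :
  measurable_fun setT (fun x => nu (closed_ball x r)).
Proof.
have [r0|r0] := ltP 0 r; last first.
  rewrite (_ : (fun _ => _) = cst 0%E)//.
  by apply/funext => x; rewrite closed_ball0// measure0.
rewrite (_ : (fun _ => _) = nu \o xsection [set z : R * R | `|z.1 - z.2| <= r]).
  by apply: measurable_fun_xsection; exact: measurable_near.
apply/funext => x /=; rewrite closed_ball_norm//; congr (nu _).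
by apply/seteqP; split => y; rewrite /xsection /= inE.
Qed.

Lemma correlation_markov r (h : R) : 0 < h ->
  (h%:E * nu [set x | (h%:E <= nu (closed_ball x r))%E] <=
   correlation_integral nu r)%E.
Proof.
move=> h0.
have := @le_integral_comp_abse _ _ R nu setT measurableT
  (fun x => nu (closed_ball x r)) h id (@measurable_id _ _ _) (fun _ H =>
    H) (fun _ _ _ _ H => H)
  (measurable_measure_closed_ball r) h0.
rewrite setTI => /le_trans H.
rewrite (_ : [set x | _] = [set x | (`|nu (closed_ball x r)| >= h%:E)%E]).
  by apply: H; rewrite (eq_integral (fun x => nu (closed_ball x r)))// => x _;
    rewrite /= gee0_abs.
by apply/seteqP; split => x /=; rewrite gee0_abs.
Qed.

Lemma expn_small (y e : R) : 0 < y < 1 -> 0 < e ->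
  exists n, forall k, (n <= k)%N -> y ^+ k < e.
Proof.
move=> y01 e0; have /andP[y0 y1] := y01.
have [|n /andP[ye _]] := @geometric_scale R y (Num.min 1 e) y01.
  by rewrite lt_min ltr01 e0 ge_min lexx.
exists n.+1 => k nk; apply: (@le_lt_trans _ _ (y ^+ n.+1)).
  by apply: ler_wiXn2l => //; exact: ltW.
by apply: (lt_le_trans ye); rewrite ge_min lexx orbT.
Qed.

Variables (C r0 s : R).
Hypotheses (r0_gt0 : 0 < r0).
Hypothesis corr_le : forall r, 0 < r < r0 ->
  (correlation_integral nu r <= (C * r `^ s)%:E)%E.

(** By Markov's inequality, points whose ball of radius d has mass at least d^s' have measure at
    most C d^(s-s'). This is summable along a geometric sequence of radii, and off the union of
    these sets the mass is controlled at every radius of the sequence, hence at all small radii up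
    to a constant. *)
Lemma correlation_large_set s' : 0 < s' < s ->
  exists A, [/\ measurable A, ((2^-1)%:E <= nu A)%E &
  exists C' r1, [/\ 0 < C', 0 < r1 <= 1 & forall x r, A x -> 0 <= r < r1 ->
    (nu `[(x - r)%R, (x + r)%R]%classic <= (C' * r `^ s')%:E)%E]].
Proof.
move=> /andP[s'0 s's]; have ss : 0 < s - s' by rewrite subr_gt0.
have h2 : 0 < (2^-1 : R) < 1 by rewrite invr_gt0 ltr0n /= invf_lt1// ltr1n.
have h20 : 0 < 2^-1 :> R by case/andP: h2.
(* With this ratio the exceptional measures at least halve at each scale; [k0] then makes their sum
   at most 1/2. *)
have [rho /andP[rho0 rho1] rhoh] := exists_powR_le ss h20.
have {rho1}rho1 : rho < 1.
  rewrite lt_neqAle rho1 andbT; apply/eqP => r1.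
  by move: rhoh; rewrite r1 powR1; lra.
have rho01 : 0 < rho < 1 by rewrite rho0.
pose C1 := `|C| + 1; have C10 : 0 < C1 by rewrite ltr_wpDl.
have c4 : 0 < (4 * C1)^-1 by rewrite invr_gt0 mulr_gt0.
have [n1 n1P] := expn_small h2 c4.
have [n2 n2P] := expn_small rho01 r0_gt0.
have [k0 n1k0 n2k0] : exists2 k0, (n1 <= k0)%N & (n2 <= k0)%N.
  by exists (maxn n1 n2); rewrite ?leq_maxl ?leq_maxr.
pose d i := rho ^+ (k0 + i).
have d0 i : 0 < d i by rewrite exprn_gt0.
have dr0 i : d i < r0.
  by apply: n2P; apply: leq_trans (leq_addr _ _).
pose B i := [set x | ((d i `^ s')%:E <= nu (closed_ball x (d i)))%E].
have mB i : measurable (B i).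
  rewrite -[B i]setTI; apply: emeasurable_fun_c_infty => //.
  exact: measurable_measure_closed_ball.
have nuB i : (nu (B i) <= (2^-1 / (2 ^ i.+1)%:R)%:E)%E.
  have ds' : 0 < d i `^ s' by rewrite powR_gt0.
  have := correlation_markov (d i) ds'; rewrite -/(B i).
  have -> : nu (B i) = (fine (nu (B i)))%:E by rewrite fineK// fin_num_measure.
  move=> /le_trans; move=> /(_ _ (corr_le (introT andP (conj (d0 i) (dr0 i))))).
  rewrite -EFinM !lee_fin => h.
  rewrite -(ler_pM2l ds'); apply: (le_trans h).
  rewrite -(powR_mulB s' s (d0 i)) mulrCA ler_pM2l//.
  have dE : d i `^ (s - s') <= 2^-1 ^+ (k0 + i).
    rewrite /d powR_expn//.
    by apply: lerXn2r; rewrite ?nnegrE ?powR_ge0 ?(ltW h20).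
  apply: (@le_trans _ _ (C1 * 2^-1 ^+ (k0 + i))).
    apply: (@le_trans _ _ (C1 * d i `^ (s - s'))).
      by rewrite ler_wpM2r ?powR_ge0// (le_trans (ler_norm C))// lerDl.
    by rewrite ler_pM2l.
  rewrite exprD mulrA.
  have : C1 * 2^-1 ^+ k0 <= 4^-1.
    by have := n1P k0 n1k0; rewrite invfM ltr_pdivlMr// mulrC => /ltW.
  have -> : 2^-1 / (2 ^ i.+1)%:R = 4^-1 * 2^-1 ^+ i :> R.
    by rewrite natrX exprS exprVn; field.
  by rewrite ler_pM2r ?exprn_gt0.
pose A := ~` (\bigcup_i B i).
have mU : measurable (\bigcup_i B i) by exact: bigcup_measurable.
have AB x i : A x -> (nu (closed_ball x (d i)) < (d i `^ s')%:E)%E.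
  by move=> Ax; rewrite ltNge; apply/negP => Bx; apply: Ax; exists i.
have pos x r : A x -> 0 < r < rho ^+ k0 ->
    (nu `[(x - r)%R, (x + r)%R]%classic <= (rho `^ (- s') * r `^ s')%:E)%E.
  move=> Ax /andP[rp rk].
  have r1 : r <= 1 by rewrite (le_trans (ltW rk))// exprn_ile1 ?ltW.
  have [n /andP[nr rn]] := geometric_scale rho01 (introT andP (conj rp r1)).
  have k0n : (k0 <= n)%N.
    rewrite leqNgt; apply/negP => nk.
    have : rho ^+ k0 <= rho ^+ n.+1 by apply: ler_wiXn2l; rewrite ?ltW.
    lra.
  have := AB x (n - k0)%N Ax; rewrite /d subnKC// => /ltW h.
  apply: (@le_trans _ _ (nu (closed_ball x (rho ^+ n)))).
    apply: le_measure; rewrite ?inE//; first exact: measurable_closed_ball.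
    rewrite closed_ball_itv ?exprn_gt0// => y /=; rewrite !in_itv/=; lra.
  apply: (le_trans h); rewrite lee_fin powRN -ler_pdivrMl ?invr_gt0 ?powR_gt0//.
  rewrite invrK -powRM ?exprn_ge0 ?(ltW rho0)//.
  by apply: ge0_ler_powR;
    rewrite ?nnegrE ?mulr_ge0 ?exprn_ge0 ?(ltW rho0) ?(ltW s'0) ?(ltW rp)// -exprS ltW.
exists A; split; first exact: measurableC.
  rewrite /A probability_setC//.
  have : (nu (\bigcup_i B i) <= (2^-1)%:E)%E.
    apply: (le_trans (le_mu_bigcup _ mB mU)).
    apply: le_trans (epsilon_trick0 xpredT (ltW h20)).
    by apply: lee_nneseries => [i _ _|i _]; [exact: measure_ge0|exact: nuB].
  have := fineK (fin_num_measure nu _ mU); set u := fine _ => <-.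
  by rewrite -EFinB !lee_fin; lra.
exists (rho `^ (- s')), (rho ^+ k0); split; first by rewrite powR_gt0.
  by rewrite exprn_gt0//= exprn_ile1 ?ltW.
move=> x r Ax /andP[]; rewrite le_eqVlt => /orP[/eqP <- _|rp rk]; last first.
  by apply: pos => //; rewrite rp.
(* Radius 0: a point has at most the mass of the intervals around it, which tends to 0 with the
   radius. *)
rewrite powR0 ?gt_eqF// mulr0; apply/lee_addgt0Pr => e e0; rewrite add0e.
have rs0 : 0 < rho `^ (- s') by rewrite powR_gt0.
have [q /andP[q0 q1] qe] := exists_powR_le s'0 (divr_gt0 e0 rs0).
pose q' := Num.min q (rho ^+ k0 / 2).
have rk0 : 0 < rho ^+ k0 by rewrite exprn_gt0.
have rr : 0 < q' < rho ^+ k0.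
  by rewrite lt_min q0 divr_gt0//= gt_min ltr_pdivrMr// ltr_pMr// ltr1n orbT.
apply: (le_trans _ (le_trans (pos x q' Ax rr) _)).
  apply: le_measure; rewrite ?inE//.
  by move=> y /=; rewrite !in_itv/=; case/andP: rr; lra.
rewrite lee_fin mulrC -ler_pdivlMr//; apply: le_trans qe.
apply: ge0_ler_powR; rewrite ?nnegrE ?(ltW s'0) ?(ltW q0)//.
  by case/andP: rr => /ltW.
by rewrite ge_min lexx.
Qed.

Variable E : set R.
Hypothesis full : forall V, measurable V -> E `<=` V -> nu V = 1%E.

Lemma correlation_dim_ge :
  (s%:E <= hausdorff_dim E)%E /\ (s%:E <= packing_dim E)%E.
Proof.
have key u : 0 <= u -> u < s -> hausdorff_measure u E <> 0%E /\ packing_measure u E <> 0%E.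
  move=> u0 us; pose s' := (u + s) / 2.
  have s's : 0 < s' < s by rewrite /s'; lra.
  have [A [mA A2 [C' [r1 [C'0 /andP[r10 r11] up]]]]] :=
    correlation_large_set s's.
  have up' x r : A x -> 0 <= r < r1 ->
      (nu `[(x - r)%R, (x + r)%R]%classic <= (C' * r `^ u)%:E)%E.
    move=> Ax rr; apply: (le_trans (up x r Ax rr)); rewrite lee_fin ler_pM2l//.
    have /andP[] := rr; rewrite le_eqVlt => /orP[/eqP <- _|rp rlt].
      by rewrite powR0 ?powR_ge0// gt_eqF//; case/andP: s's.
    apply: ger_powR; first by rewrite rp; lra.
    by rewrite /s'; lra.
  (* The union of V and the complement of A contains E, so it has mass 1, of which the complement of
     A carries at most 1/2. *)
  have full' V : measurable V -> A `&` E `<=` V -> ((2^-1)%:E <= nu V)%E.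
    move=> mV AEV.
    have : nu (V `|` ~` A) = 1%E.
      apply: full => [|x Ex]; first by apply: measurableU => //;
        exact: measurableC.
      by have [Ax|] := pselect (A x); [left; exact: AEV|right].
    have mA' := measurableC mA.
    move=> VA1; have : (nu (V `|` ~` A) <= nu V + nu (~` A))%E
      by exact: measureU2.
    rewrite VA1 probability_setC//; move: A2.
    have := fineK (fin_num_measure nu _ mA); set w := fine _ => <-.
    have := fineK (fin_num_measure nu _ mV); set v := fine _ => <-.
    by rewrite -EFinB -EFinD !lee_fin; lra.
  have h2 : 0 < 2^-1 :> R by rewrite invr_gt0.
  split; first exact: (hausdorff_measure_neq0 C'0 r10 up' h2 full').
  exact: (packing_measure_neq0 C'0 r10 u0 up' h2 full').
split; apply: le_ereal_inf_tmp => _ [u /= [u0 uE] <-]; rewrite lee_fin leNgt;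
  apply/negP => us; have [h1 h2] := key u u0 us.
  exact: h1.
exact: h2.
Qed.

End Correlation.

(** * Convolutions of Cantor measures *)

Section Truncation.
Context {R : realType}.
Implicit Types (a : R) (w : nat -> bool).

Lemma cval_mkseq a w k :
  cval a (mkseq w k) = (1 - a) * series (fun j => (w j)%:R * a ^+ j) k.
Proof.
elim: k => [|k IH]; first by rewrite /series /= big_geq// mulr0.
rewrite mkseqS -cats1 cval_cat IH size_mkseq /series /= big_nat_recr//=.
by ring.
Qed.

Lemma is_cvg_cantor_series a w : 0 < a < 1 ->
  cvgn (series (fun j => (w j)%:R * a ^+ j)).
Proof.
move=> /andP[a0 a1].
have : cvgn (series (geometric 1 a)).
  by apply: is_cvg_geometric_series; rewrite gtr0_norm.
apply: series_le_cvg => n /=; rewrite ?mul1r.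
- by rewrite mulr_ge0// exprn_ge0// ltW.
- by rewrite exprn_ge0// ltW.
- by apply: ler_piMl; [rewrite exprn_ge0// ltW|case: (w n)].
Qed.

Lemma cantor_sum_itv a w n : 0 < a < 1 ->
  0 <= cantor_sum a w - cval a (mkseq w n) <= a ^+ n.
Proof.
move=> a01; have /andP[a0 a1] := a01.
have a1' : 0 < 1 - a by rewrite subr_gt0.
have bnd k : (n <= k)%N -> 0 <= cval a (mkseq w k) - cval a (mkseq w n) <= a ^+ n.
  move=> nk; have := cval_cat_itv (mkseq w n) (mkseq (w \o addn n) (k - n)) a01.
  rewrite size_mkseq /mkseq map_comp -iotaDl addn0 -map_cat -iotaD.
  by rewrite subnKC.
rewrite subr_ge0 lerBlDr /cantor_sum.
have cv := is_cvg_cantor_series (w := w) a01.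
apply/andP; split.
  rewrite -ler_pdivrMl//; apply: limr_ge => //; near=> k.
  rewrite ler_pdivrMl// -cval_mkseq -subr_ge0.
  suff /bnd/andP[] : (n <= k)%N by [].
  by near: k; exact: nbhs_infty_ge.
rewrite -ler_pdivlMl//; apply: limr_le => //; near=> k.
rewrite ler_pdivlMl// -cval_mkseq -lerBlDr.
suff /bnd/andP[] : (n <= k)%N by [].
by near: k; exact: nbhs_infty_ge.
Unshelve. all: by end_near. Qed.

End Truncation.

(** * Laws of finite coin words *)

Section Coins.
Context {R : realType} {d : measure_display} {Om : measurableType d}.
Variables (P : probability Om R) (omega : nat -> {RV P >-> bool}).
Hypothesis coins : fair_coins P omega.

Definition coin_word n (t : Om) := mkseq (fun j => omega j t) n.

Lemma measurable_coin_word n w : measurable (coin_word n @^-1` [set w]).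
Proof.
have [sw|sw] := eqVneq (size w) n; last first.
  rewrite (_ : _ @^-1` _ = set0)//; apply/seteqP; split => // t /= E.
  by move: sw; rewrite -E size_mkseq eqxx.
rewrite (_ : _ @^-1` _ = \bigcap_(i in `I_n) (omega i @^-1` [set nth false w i])).
  apply: fin_bigcap_measurable => // i _.
  by rewrite -[X in measurable X]setTI; exact: measurable_funP.
apply/seteqP; split => t /=.
  by move=> E i /= ni /=; rewrite -E nth_mkseq.
move=> E; apply: (@eq_from_nth _ false); rewrite ?size_mkseq// => i ni.
by rewrite nth_mkseq//; exact: E.
Qed.

Lemma prod_EFin_cst (I : Type) (s : seq I) (c : R) :
  \big[*%E/1%E]_(i <- s) c%:E = (c ^+ size s)%:E.
Proof. by elim: s => [|x s IH]; rewrite ?big_nil// big_cons IH /= exprS. Qed.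

Lemma coin_word_prob n w : size w = n ->
  P (coin_word n @^-1` [set w]) = (2^-1 ^+ n)%:E.
Proof.
move=> sw; have [indep fair] := coins.
pose J := [fset i in iota 0 n]%fset.
have := indep J (fun i => [set nth false w i]) (fun _ => I).
rewrite (_ : \bigcap_(i in _) _ = coin_word n @^-1` [set w]); last first.
  apply/seteqP; split => t /=.
    move=> E; apply: (@eq_from_nth _ false); rewrite ?size_mkseq// => i ni.
    rewrite nth_mkseq//; apply: E => /=.
    by rewrite /J !inE mem_iota.
  move=> E i /=; rewrite /J !inE mem_iota add0n => /= jn.
  by rewrite -E nth_mkseq.
move=> ->.
rewrite (eq_bigr (fun=> (2^-1)%:E)).
  by rewrite prod_EFin_cst card_fseq undup_id ?iota_uniq// size_iota.
move=> i _; have [f0 f1] := fair i.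
by case: (nth false w i).
Qed.

(** The link between the measures and the collision sums: events on finitely many digits have the
    frequency of the corresponding words as probability. *)
Lemma coin_words_prob n m (h : pred (seq bool * seq bool)) :
  measurable [set z : Om * Om | h (coin_word n z.1, coin_word m z.2)] /\
  (P \x P)%E [set z | h (coin_word n z.1, coin_word m z.2)] =
  (avg (wpairs n m) (fun p => (h p)%:R))%:E.
Proof.
pose D := seq.filter h (wpairs n m).
pose G (p : seq bool * seq bool) : set (Om * Om) :=
  (coin_word n @^-1` [set p.1]) `*` (coin_word m @^-1` [set p.2]).
have -> : [set z : Om * Om | h (coin_word n z.1, coin_word m z.2)] =
    \bigcup_(p in [set` D]) G p.
  apply/seteqP; split => z /=.
    move=> hz; exists (coin_word n z.1, coin_word m z.2) => //=.
    by rewrite mem_filter hz mem_wpairs !size_mkseq !eqxx.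
  by move=> [[u v] /=]; rewrite mem_filter => /andP[huv _] [/= -> ->].
have mG p : measurable (G p) by apply: measurableX; exact: measurable_coin_word.
split; first by apply: fin_bigcup_measurable => // p _; exact: mG.
rewrite measure_fin_bigcup; [|exact: finite_seq| |by move=> p _; exact: mG];
  last first.
  apply/trivIsetP => -[u v] [u' v'] _ _ ne; apply/seteqP; split => // z.
  by move=> [[/= E1 E2] [/= E3 E4]]; move: ne; rewrite -E1 -E2 -E3 -E4 eqxx.
have uD : uniq D.
  by rewrite filter_uniq// allpairs_uniq ?words_uniq// =>
    -[? ?] [? ?] _ _ [-> ->].
rewrite -fsbig_seq//.
have GE p : p \in D -> (P \x P)%E (G p) = (2^-1 ^+ n * 2^-1 ^+ m)%:E.
  rewrite mem_filter mem_wpairs => /andP[_ /andP[/eqP p1 /eqP p2]].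
  rewrite EFinM -(coin_word_prob p1) -(coin_word_prob p2).
  by apply: product_measure1E; exact: measurable_coin_word.
transitivity (\sum_(p <- D) (2^-1 ^+ n * 2^-1 ^+ m : R)%R%:E)%E.
  by apply: eq_big_seq => p pD; exact: GE.
rewrite big_filter sumEFin; congr EFin.
rewrite /avg size_allpairs !size_words -expnD natrX -exprVn mulr_suml big_mkcond.
apply: eq_bigr => p _; rewrite -exprD.
by case: (h p); rewrite ?mul1r ?mul0r.
Qed.

End Coins.

Section Convolution.
Context {R : realType} {d : measure_display} {Om : measurableType d}.
Variables (P : probability Om R) (omega : nat -> {RV P >-> bool}).
Variables (a b lambda : R).
Hypothesis coins : fair_coins P omega.
Hypotheses (ha : 0 < a < 2^-1) (hb : 0 < b < 2^-1).

Local Notation nu := (convolution (cantor_measure P ha omega)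
                      (scaled lambda (cantor_measure P hb omega))).
Let a01 := lt01_of ha.
Let b01 := lt01_of hb.
Let a0 : 0 < a. Proof. by case/andP: ha. Qed.
Let b0 : 0 < b. Proof. by case/andP: hb. Qed.

(** The convolution is taken through the product measure: [z.1] and [z.2] are independent samples,
    although both series use the same coins. *)
Definition conv_sum (z : Om * Om) : R :=
  cantor_sum a (fun j => omega j z.1) + lambda * cantor_sum b (fun j =>
    omega j z.2).

Lemma measurable_conv_sum : measurable_fun setT conv_sum.
Proof.
apply: measurable_funD.
  apply: (measurableT_comp (measurable_random_cantor_sum ha omega)).
  exact: measurable_fst.
apply: measurable_funM => //.
apply: (measurableT_comp (measurable_random_cantor_sum hb omega)).
exact: measurable_snd.
Qed.

Lemma measurable_conv_preimage (B : set R) : measurable B ->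
  measurable (conv_sum @^-1` B).
Proof.
by move=> mB; rewrite -[X in measurable X]setTI; exact: measurable_conv_sum.
Qed.

Lemma convE (B : set R) : measurable B -> nu B = (P \x P)%E (conv_sum @^-1` B).
Proof.
move=> mB.
have mA : measurable ((@Defs.add_pair R) @^-1` B).
  by rewrite -[X in measurable X]setTI; exact: measurable_add_pair.
transitivity (\int[cantor_measure P ha omega]_x
  (scaled lambda (cantor_measure P hb omega)) (xsection ((@Defs.add_pair R) @^-1` B) x))%E.
  by [].
rewrite ge0_integral_distribution//.
exact: measurable_fun_xsection.
Qed.

(* The error made by truncating the two series at [n] and [m] digits. *)
Definition trunc_err n m : R := a ^+ n + `|lambda| * b ^+ m.

Lemma conv_sum_near z n m :
  `|conv_sum z - pt a b lambda (coin_word omega n z.1, coin_word omega m z.2)| <=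
  trunc_err n m.
Proof.
have /andP[h1 h2] := cantor_sum_itv (fun j => omega j z.1) n a01.
have /andP[h3 h4] := cantor_sum_itv (fun j => omega j z.2) m b01.
rewrite /conv_sum /pt /coin_word /= opprD addrACA -mulrBr.
apply: (le_trans (ler_normD _ _)); rewrite normrM (ger0_norm h1) (ger0_norm h3).
by rewrite lerD// ler_wpM2l.
Qed.


Lemma conv_support (V : set R) : measurable V ->
  (forall w w', V (cantor_sum a w + lambda * cantor_sum b w')) -> nu V = 1%E.
Proof.
move=> mV sub; rewrite convE// (_ : conv_sum @^-1` V = setT).
  by rewrite -(convE measurableT) probability_setT.
by apply/seteqP; split => // z _; exact: sub.
Qed.

Let nu_near (x r : R) : nu [set y | `|x - y| <= r] =
  (P \x P)%E [set z | `|x - conv_sum z| <= r].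
Proof.
rewrite convE// (_ : [set y | _] = `[x - r, x + r]%classic)//.
by apply/seteqP; split => y /=; rewrite in_itv/= ler_norml; lra.
Qed.

Let measurable_conv_near (x r : R) :
  measurable [set z | `|x - conv_sum z| <= r].
Proof.
rewrite (_ : [set z | _] = conv_sum @^-1` `[x - r, x + r]%classic).
  exact: measurable_conv_preimage.
by apply/seteqP; split => z /=; rewrite in_itv/= ler_norml; lra.
Qed.

Lemma conv_near_le n m (x r : R) :
  (nu [set y | `|x - y| <= r]%R <= (avg (wpairs n m) (fun p =>
    (`|x - pt a b lambda p| <= r + trunc_err n m)%R%:R))%:E)%E.
Proof.
have [mh <-] := coin_words_prob coins n m
  (fun p => `|x - pt a b lambda p| <= r + trunc_err n m).
rewrite nu_near; apply: le_measure; rewrite ?inE// => z /= le.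
set p := (_, _); have := conv_sum_near z n m; rewrite -/p -/(trunc_err n m) =>
  h.
rewrite (_ : x - _ = (x - conv_sum z) + (conv_sum z - pt a b lambda p)); last
  by ring.
by apply: (le_trans (ler_normD _ _)); rewrite lerD.
Qed.

Lemma conv_near_ge n m (x r : R) :
  ((avg (wpairs n m) (fun p =>
    (`|x - pt a b lambda p| <= r - trunc_err n m)%R%:R))%:E <=
   nu [set y | `|x - y| <= r]%R)%E.
Proof.
have [mh <-] := coin_words_prob coins n m
  (fun p => `|x - pt a b lambda p| <= r - trunc_err n m).
rewrite nu_near; apply: le_measure; rewrite ?inE// => z /=.
set p := (_, _); have := conv_sum_near z n m; rewrite -/p -/(trunc_err n m) =>
  h le.
rewrite (_ : x - _ = (x - pt a b lambda p) - (conv_sum z - pt a b lambda p));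
  last by ring.
apply: (le_trans (ler_normB _ _)).
by move: le h; lra.
Qed.

Let near_set (r : R) p := [set y | `|pt a b lambda p - y| <= r].

Let measurable_near_set (r : R) p : measurable (near_set r p).
Proof.
rewrite (_ : near_set r p = `[pt a b lambda p - r, pt a b lambda p + r]%classic)//.
by apply/seteqP; split => y; rewrite /near_set /= in_itv/= ler_norml; lra.
Qed.

Let near_avg n m (r x : R) : R :=
  avg (wpairs n m) (fun p => (`|x - pt a b lambda p| <= r)%R%:R).

Let near_avgE n m (r x : R) : (near_avg n m r x)%:E =
  (\sum_(p <- wpairs n m)
    (((size (wpairs n m))%:R^-1)%:E * (\1_(near_set r p) x)%:E))%E.
Proof.
rewrite /near_avg /avg mulrC mulr_sumr -sumEFin.
apply: eq_bigr => p _; rewrite -EFinM; congr (_ * _)%:E.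
rewrite indicE distrC;
  suff -> : (`|pt a b lambda p - x| <= r) = (x \in near_set r p) by [].
by apply/idP/idP => [h|/set_mem//]; exact: mem_set.
Qed.

Let measurable_near_avg n m r : measurable_fun setT (EFin \o near_avg n m r).
Proof.
rewrite (_ : _ \o _ = fun x => (\sum_(p <- wpairs n m)
    (((size (wpairs n m))%:R^-1)%:E * (\1_(near_set r p) x)%:E))%E); last first.
  by apply/funext => x; exact: near_avgE.
apply: emeasurable_sum => p; apply: measurable_funeM.
by apply/measurable_EFinP.
Qed.

Let integral_avg n m (r : R) : (\int[nu]_x (near_avg n m r x)%:E =
   \sum_(p <- wpairs n m) ((size (wpairs n m))%:R^-1)%:E * nu (near_set r p))%E.
Proof.
under eq_integral do rewrite near_avgE.
rewrite ge0_integral_sum//.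
- apply: eq_bigr => p _; rewrite ge0_integralZl//.
  + by rewrite integral_indic// setIT.
  + exact/measurable_EFinP.
- by move=> p; apply: measurable_funeM; exact/measurable_EFinP.
Qed.

(** Both points of the double integral are replaced by truncations, the inner one by [conv_near_le]
    and then, after integration, the outer one; each costs one [trunc_err] in the radius. *)
Lemma correlation_le_pcoll n m (r : R) : 0 < r ->
  (correlation_integral nu r <= (pcoll a b lambda n m (r + 2 * trunc_err n m))%:E)%E.
Proof.
move=> r0.
apply: (@le_trans _ _ (\int[nu]_x (near_avg n m (r + trunc_err n m) x)%:E)%E).
  apply: ge0_le_integral => //.
  - exact: measurable_measure_closed_ball.
  - exact: measurable_near_avg.
  - by move=> x _; rewrite closed_ball_norm// conv_near_le.
rewrite integral_avg /pcoll /coll [X in (_ <= X%:E)%E]/avg mulrC mulr_sumr -sumEFin.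
apply: lee_sum => p _; rewrite EFinM; apply: lee_wpmul2l.
  by rewrite lee_fin invr_ge0.
apply: (le_trans (conv_near_le n m _ _)).
by rewrite (_ : r + trunc_err n m + trunc_err n m = r + 2 * trunc_err n m)//;
  ring.
Qed.

Lemma pcoll_le_correlation n m (r : R) : 0 < r ->
  ((pcoll a b lambda n m (r - 2 * trunc_err n m))%:E <= correlation_integral nu r)%E.
Proof.
move=> r0.
apply: (@le_trans _ _ (\int[nu]_x (near_avg n m (r - trunc_err n m) x)%:E)%E);
  last first.
  apply: ge0_le_integral => //.
  - by move=> x _; rewrite lee_fin; apply: avg_ge0 => p _; rewrite ler0n.
  - exact: measurable_near_avg.
  - exact: measurable_measure_closed_ball.
  - by move=> x _; rewrite closed_ball_norm// conv_near_ge.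
rewrite integral_avg /pcoll /coll [X in (X%:E <= _)%E]/avg mulrC mulr_sumr -sumEFin.
apply: lee_sum => p _; rewrite EFinM; apply: lee_wpmul2l.
  by rewrite lee_fin invr_ge0.
apply: le_trans (conv_near_ge n m _ _).
by rewrite (_ : r - trunc_err n m - trunc_err n m = r - 2 * trunc_err n m)//;
  ring.
Qed.

End Convolution.

Lemma le_avg_term (R : realType) (I : eqType) (s : seq I) (F : I -> R) i :
  i \in s -> (forall j, 0 <= F j) -> F i / (size s)%:R <= avg s F.
Proof.
move=> si F0; rewrite ler_wpM2r ?invr_ge0 ?ler0n//.
by rewrite (big_rem i)//= lerDl sumr_ge0.
Qed.

Section BorelLebesgue.
Context {R : realType}.

(* The library's [lebesgue_measure] lives on the copy [measurableTypeR R] of [R]. *)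
Definition borel_lebesgue (A : set R) : \bar R := lebesgue_measure A.

HB.instance Definition _ := isMeasure.Build _ R R borel_lebesgue
  (measure0 lebesgue_measure) (measure_ge0 lebesgue_measure)
  (@measure_semi_sigma_additive _ _ _ lebesgue_measure).

Lemma borel_lebesgue_itv (x y : R) : x < y ->
  borel_lebesgue `[x, y]%classic = (y - x)%:E.
Proof.
move=> xy; by rewrite /borel_lebesgue lebesgue_measure_itv/= lte_fin xy.
Qed.

End BorelLebesgue.

(** * Dimension bounds for the convolution *)

Section Bounds.
Context {R : realType} {d : measure_display} {Om : measurableType d}.
Variables (P : probability Om R) (omega : nat -> {RV P >-> bool}).
Variables (a b lambda : R).
Hypothesis coins : fair_coins P omega.
Hypotheses (ha : 0 < a < 2^-1) (hb : 0 < b < 2^-1).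

Local Notation nu := (convolution (cantor_measure P ha omega)
                      (scaled lambda (cantor_measure P hb omega))).
Local Notation D := (Num.min (sdim a + sdim b) 1).
Local Notation err n m := (trunc_err a b lambda n m).

Let a01 := lt01_of ha.
Let b01 := lt01_of hb.
Let a0 : 0 < a. Proof. by case/andP: ha. Qed.
Let b0 : 0 < b. Proof. by case/andP: hb. Qed.
Let sa := sdim_gt0 a01.
Let sb := sdim_gt0 b01.

(** The cylinder of the single pair [p] has this mass and lies within [2 * err n m] of x. *)
Lemma conv_mass_ge (x r : R) n m p : 0 < r -> p \in wpairs n m ->
  `|x - pt a b lambda p| <= err n m -> 2 * err n m <= r ->
  ((2^-1 ^+ n * 2^-1 ^+ m)%:E <= nu (closed_ball x r))%E.
Proof.
move=> r0 pin xp er; rewrite closed_ball_norm//.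
apply: le_trans (conv_near_ge lambda coins ha hb n m x r).
rewrite lee_fin; apply: (le_trans _ (le_avg_term (i := p) pin _)) => [|q];
  last first.
  by rewrite ler0n.
rewrite (_ : `|_| <= _); last by lra.
by rewrite mul1r size_allpairs !size_words natrM !natrX invfM !exprVn.
Qed.

Lemma trunc_err_digits n :
  err n (digits a b n) <= (1 + `|lambda| / b) * a ^+ n.
Proof.
rewrite /trunc_err mulrDl mul1r lerD2l -mulrA ler_wpM2l//.
by rewrite mulrC ler_pdivlMr// ltW// expn_digits_lt.
Qed.

Let L1 : 0 < 1 + `|lambda| / b.
Proof. by rewrite ltr_pwDl// divr_ge0// ltW. Qed.

(** One index past the scale of [q] brings the error below r, while cylinders keep a mass comparable
    to r^(sdim a + sdim b). *)
Lemma trunc_scale (r : R) : 0 < r <= 1 ->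
  exists2 n, err n (digits a b n) <= r &
  (a / (1 + `|lambda| / b)) `^ (sdim a + sdim b) * r `^ (sdim a + sdim b) <=
  2^-1 ^+ n * 2^-1 ^+ digits a b n.
Proof.
move=> /andP[r0 r1]; pose q := r / (1 + `|lambda| / b).
have q0 : 0 < q by rewrite divr_gt0.
have q1 : q <= 1.
  by rewrite ler_pdivrMr// mul1r (le_trans r1)// lerDl divr_ge0// ltW.
have [n /andP[nq qn]] := geometric_scale a01 (introT andP (conj q0 q1)).
exists n.+1.
  apply: (le_trans (trunc_err_digits _)); rewrite mulrC -ler_pdivlMr//.
  exact: ltW.
rewrite -powRM ?divr_ge0 ?(ltW a0) ?(ltW r0) ?(ltW L1)//.
have -> : a / (1 + `|lambda| / b) * r = a * q by rewrite /q; ring.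
have aq : 0 < a * q by rewrite mulr_gt0.
have aqn : a * q <= a ^+ n.+1 by rewrite exprS ler_pM2l.
rewrite -(expn_sdim _ a01) -(expn_sdim _ b01) powRD; last first.
  by rewrite (gt_eqF aq) implybT.
apply: ler_pM; rewrite ?powR_ge0//.
  by apply: ge0_ler_powR;
    rewrite ?nnegrE ?(ltW sa) ?(ltW aq) ?exprn_ge0 ?(ltW a0).
apply: ge0_ler_powR; rewrite ?nnegrE ?(ltW sb) ?(ltW aq) ?exprn_ge0 ?(ltW b0)//.
by apply: (le_trans aqn); exact: le_expn_digits.
Qed.

(** A superset of C_a + lambda C_b, written as an intersection of finite unions of closed intervals
    so that it is visibly Borel. *)
Definition conv_attractor : set R :=
  \bigcap_n [set x | exists2 p, p \in wpairs n (digits a b n) &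
                      `|x - pt a b lambda p| <= err n (digits a b n)].

Lemma measurable_conv_attractor : measurable conv_attractor.
Proof.
apply: bigcap_measurable => [|n _]; first by exists 0.
rewrite (_ : [set _ | _] = \bigcup_(p in [set` wpairs n (digits a b n)])
   `[pt a b lambda p - err n (digits a b n),
     pt a b lambda p + err n (digits a b n)]%classic).
  by apply: fin_bigcup_measurable => //; exact: finite_seq.
apply/seteqP; split => x /= [p pin].
  by rewrite ler_norml => h; exists p => //=; rewrite in_itv/=; lra.
by rewrite /= in_itv/= => h; exists p => //; rewrite ler_norml; lra.
Qed.

Lemma cantor_sum_attractor w w' :
  conv_attractor (cantor_sum a w + lambda * cantor_sum b w').
Proof.
move=> n _ /=; set m := digits a b n; exists (mkseq w n, mkseq w' m).
  by rewrite mem_wpairs !size_mkseq !eqxx.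
have /andP[h1 h2] := cantor_sum_itv w n a01.
have /andP[h3 h4] := cantor_sum_itv w' m b01.
rewrite /pt /trunc_err /= opprD addrACA -mulrBr.
apply: (le_trans (ler_normD _ _)); rewrite normrM (ger0_norm h1) (ger0_norm h3).
by rewrite lerD// ler_wpM2l.
Qed.

Lemma conv_attractor_full : nu (~` conv_attractor) = 0%E.
Proof.
rewrite probability_setC; last exact: measurable_conv_attractor.
rewrite conv_support ?subee//; first exact: measurable_conv_attractor.
exact: cantor_sum_attractor.
Qed.

(** Every ball centered in the attractor contains a cylinder of comparable size. The radius is
    halved because [conv_mass_ge] requires twice the truncation error to be at most r. *)
Let attractor_dim_le_sum :
  (packing_dim conv_attractor <= (sdim a + sdim b)%:E)%E /\
  (hausdorff_dim conv_attractor <= (sdim a + sdim b)%:E)%E.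
Proof.
apply: (@packing_hausdorff_dim_le R nu setT _
  ((a / (1 + `|lambda| / b)) `^ (sdim a + sdim b) * 2^-1 `^ (sdim a + sdim b))) => //.
- by apply: (@le_lt_trans _ _ 1%E); [exact: probability_le1|exact: ltry].
- by rewrite mulr_gt0 ?powR_gt0 ?divr_gt0 ?invr_gt0.
- move=> x r Ex /andP[r0 r1]; split => //.
  have r2 : 0 < r / 2 <= 1 by lra.
  have [n en] := trunc_scale r2; have [//|p pin xp] := Ex n _.
  have -> : r / 2 = 2^-1 * r by ring.
  rewrite [(2^-1 * r) `^ _]powRM ?(ltW r0)// mulrA => h.
  apply: (@le_trans _ _ (2^-1 ^+ n * 2^-1 ^+ digits a b n)%:E).
    by rewrite lee_fin.
  move: (digits a b n) en pin xp {h} => m en pin xp.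
  by apply: (conv_mass_ge r0 pin xp); lra.
- by rewrite addr_ge0 ?ltW.
Qed.

Let attractor_dim_le1 :
  (packing_dim conv_attractor <= 1%:E)%E /\ (hausdorff_dim conv_attractor <= 1%:E)%E.
Proof.
(* Level 0 places the attractor within 1 + |lambda| of the origin, and balls of radius at most 1 add
   1. Lebesgue measure then serves as mass, a ball of radius r having mass 2r. *)
pose M := 2 + `|lambda|.
apply: (@packing_hausdorff_dim_le R borel_lebesgue `[- M, M]%classic conv_attractor 2 1) => //.
- by rewrite /= borel_lebesgue_itv ?ltry// /M; have := normr_ge0 lambda; lra.
- move=> x r Ex /andP[r0 r1].
  have [//|p] := Ex 0 _; rewrite digits0 mem_wpairs !size_eq0.
  case: p => u v /= /andP[/eqP -> /eqP ->].
  rewrite /pt /trunc_err /= mulr0 addr0 subr0 !expr0 mulr1 ler_norml => xM.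
  rewrite closed_ball_itv//; split.
    by move=> y /=; rewrite !in_itv/= /M; lra.
  rewrite /= borel_lebesgue_itv; last by lra.
  by rewrite lee_fin powRr1 ?(ltW r0)//; lra.
Qed.

Lemma attractor_dim_le :
  (packing_dim conv_attractor <= D%:E)%E /\ (hausdorff_dim conv_attractor <= D%:E)%E.
Proof.
have [p1 h1] := attractor_dim_le_sum; have [p2 h2] := attractor_dim_le1.
by rewrite EFin_min !le_min p1 h1 p2.
Qed.

Lemma correlation_ge : exists2 c : R, 0 < c & forall r, 0 < r <= 1 ->
  ((c * r `^ D)%:E <= correlation_integral nu r)%E.
Proof.
pose s := sdim a + sdim b.
pose c1 := (a / (1 + `|lambda| / b)) `^ s * 4^-1 `^ s.
have c10 : 0 < c1 by rewrite mulr_gt0 ?powR_gt0 ?divr_gt0 ?invr_gt0.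
(* Chosen so that (2T + 1) r <= k for the [T] below, which satisfies (T - 1) r/2 <= 1 + |lambda|. *)
pose k := 4 * (1 + `|lambda|) + 3.
have k0 : 0 < k by rewrite addr_gt0// mulr_gt0// ltr_pwDl.
exists (Num.min c1 k^-1); first by rewrite lt_min c10 invr_gt0.
move=> r /andP[r0 r1]; have r4 : 0 < r / 4 <= 1 by lra.
have [n en h] := trunc_scale r4.
apply: le_trans (pcoll_le_correlation lambda coins ha hb n (digits a b n) r0).
move: (digits a b n) en h => m en h.
rewrite lee_fin; apply: (@le_trans _ _ (pcoll a b lambda n m (r / 2)));
  last first.
  by apply: le_pcoll; move: en {h}; set e := trunc_err _ _ _ _ _ => en; lra.
have [s1|s1] := leP s 1.
  apply: (@le_trans _ _ (c1 * r `^ s)).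
    by rewrite ler_wpM2r ?powR_ge0// ge_min lexx.
  apply: (@le_trans _ _ (2^-1 ^+ n * 2^-1 ^+ m)).
    move: h; have -> : r / 4 = 4^-1 * r by ring.
    by rewrite [(4^-1 * r) `^ _]powRM ?(ltW r0)// mulrA.
  have -> : 2^-1 ^+ n * 2^-1 ^+ m =
      avg (wpairs n m) (fun=> (size (wpairs n m))%:R^-1 : R).
    by rewrite avg_wpairs_cst size_allpairs !size_words natrM !natrX invfM !exprVn.
  (* Only the diagonal pairs are kept. *)
  apply: le_avg => p pin.
  apply: le_trans (le_avg_term pin _) => [|q]; last by rewrite ler0n.
  by rewrite subrr normr0 (_ : 0 <= r / 2) ?mul1r//; lra.
rewrite powRr1 ?(ltW r0)//; apply: (@le_trans _ _ (k^-1 * r)).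
  by rewrite ler_pM2r// ge_min lexx orbT.
have r2 : 0 < r / 2 by lra.
(* At radius T r/2, at least the diameter of the system, all pairs collide; [coll_scale_le] read
   backwards then bounds the collision sum at r/2 from below. *)
pose T := (Num.truncn ((1 + `|lambda|) / (r / 2))).+1.
have q0 : 0 <= (1 + `|lambda|) / (r / 2) by rewrite divr_ge0 ?addr_ge0// ltW.
have T1 : 1 + `|lambda| <= T%:R * (r / 2).
  by rewrite -ler_pdivrMr// ltW// truncnS_gt.
have T2 : (T%:R - 1) * (r / 2) <= 1 + `|lambda|.
  rewrite -ler_pdivlMr// /T -natr1 addrK.
  by have /andP[] := truncn_itv q0.
have := coll_scale_le (wpairs n m) (pt a b lambda) T r2.
have -> : coll (wpairs n m) (pt a b lambda) (T%:R * (r / 2)) = 1.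
  apply/eqP; rewrite eq_le pcoll_le1 /=.
  rewrite -[leLHS](avg_wpairs_cst n m); apply: le_avg => p _.
  rewrite -[leLHS](avg_wpairs_cst n m); apply: le_avg => q _.
  by rewrite (_ : `|_| <= _)// (le_trans _ T1)// pt_dist_le.
rewrite natrD natrM -/(pcoll a b lambda n m (r / 2)); set X :=
  pcoll _ _ _ _ _ _.
have X0 : 0 <= X by exact: coll_ge0.
move=> TX; rewrite ler_pdivrMl//.
have Tk : (2 * T%:R + 1) * r <= k by rewrite /k; lra.
have := ler_wpM2r X0 Tk; nra.
Qed.

Hypothesis l0 : lambda != 0.
Hypothesis irr : irrational (ln b / ln a).

Lemma correlation_le (e : R) : 0 < e ->
  exists C r0 : R, [/\ 0 < C, 0 < r0 <= 1 & forall r, 0 < r < r0 ->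
    (correlation_integral nu r <= (C * r `^ (D - e))%:E)%E].
Proof.
move=> e0; have D0 : 0 < D by rewrite lt_min ltr01 addr_gt0.
(* Capping [e] by D keeps the exponent nonnegative, so that powers are monotone in r when r is
   compared with the neighbouring scales y^k. *)
pose e' := Num.min e D; have e'0 : 0 < e' by rewrite lt_min e0.
have De' : 0 <= D - e' by rewrite subr_ge0 ge_min lexx orbT.
have [L L0 [k0 decay]] := pcoll_decay ha hb l0 irr e'0.
pose y := a ^+ L.
have y0 : 0 < y by rewrite exprn_gt0.
have y1 : y < 1 by rewrite exprn_ilt1 ?(ltW a0) -?lt0n//; case/andP: a01.
have y01 : 0 < y < 1 by rewrite y0.
pose T := (Num.truncn (1 + 2 * (1 + `|lambda| / b))).+1.
have TL : 1 + 2 * (1 + `|lambda| / b) <= T%:R by apply/ltW/truncnS_gt.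
exists ((2 * T + 1)%:R * (y `^ (D - e'))^-1), (y ^+ k0); split.
- by rewrite mulr_gt0 ?invr_gt0 ?powR_gt0// ltr0n addn1.
- by rewrite exprn_gt0//= exprn_ile1 ?(ltW y0) ?(ltW y1).
move=> r /andP[r0 rk].
have r1 : r <= 1.
  by apply: (le_trans (ltW rk)); rewrite exprn_ile1 ?(ltW y0) ?(ltW y1).
have [k /andP[kr rk']] := geometric_scale y01 (introT andP (conj r0 r1)).
have k0k : (k0 <= k)%N.
  rewrite leqNgt; apply/negP => kk.
  have : y ^+ k0 <= y ^+ k.+1 by apply: ler_wiXn2l; rewrite ?(ltW y0) ?(ltW y1).
  lra.
pose n := (k * L)%N; have yk : y ^+ k = a ^+ n by rewrite /y -exprM mulnC.
apply: (le_trans (correlation_le_pcoll lambda coins ha hb n (digits a b n) r0)).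
rewrite lee_fin.
apply: (@le_trans _ _ (pcoll a b lambda n (digits a b n) (T%:R * a ^+ n))).
  apply: le_pcoll.
  have := trunc_err_digits n; rewrite -yk => err_le.
  apply: (@le_trans _ _ ((1 + 2 * (1 + `|lambda| / b)) * y ^+ k)).
    move: err_le rk'; move: (y ^+ k) (trunc_err _ _ _ _ _) (1 + `|lambda| / b).
    by move=> Y E X; lra.
  by rewrite ler_wpM2r// exprn_ge0// ltW.
have an : 0 < a ^+ n by rewrite exprn_gt0.
apply: (le_trans (coll_scale_le _ _ T an)). rewrite -mulrA; apply: ler_wpM2l =>
  //.
apply: (le_trans (decay k k0k)); rewrite -/n -yk.
rewrite mulrC ler_pdivlMr ?powR_gt0// -powRM ?exprn_ge0 ?(ltW a0)//.
apply: (@le_trans _ _ (r `^ (D - e'))).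
  apply: ge0_ler_powR => //; rewrite ?nnegrE ?(ltW r0)//.
    exact: mulr_ge0 (exprn_ge0 k (ltW y0)) (ltW y0).
  by rewrite -exprSr; exact: ltW.
apply: ger_powR; first by rewrite r0.
by rewrite lerD2l lerN2 ge_min lexx.
Qed.

Lemma conv_dim_ge (E : set R) : measurable E -> nu (~` E) = 0%E ->
  (D%:E <= hausdorff_dim E)%E /\ (D%:E <= packing_dim E)%E.
Proof.
move=> mE E0.
have full V : measurable V -> E `<=` V -> nu V = 1%E.
  move=> mV EV; apply/eqP; rewrite eq_le probability_le1//=.
  have : (nu E <= nu V)%E by apply: le_measure; rewrite ?inE.
  suff -> : nu E = 1%E by [].
  by rewrite -(setCK E) probability_setC ?E0 ?sube0//; exact: measurableC.
have key e : 0 < e -> ((D - e)%:E <= hausdorff_dim E)%E /\ ((D - e)%:E <= packing_dim E)%E.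
  move=> e0; have [C [r0 [C0 /andP[r00 r01] up]]] := correlation_le e0.
  exact: (correlation_dim_ge r00 up full).
split; apply/lee_addgt0Pr => e e0; rewrite -leeBlDr// -EFinB;
  by have [] := key e e0.
Qed.

End Bounds.

(** * Dimension of the central Cantor set *)

Section CantorDimension.
Context {R : realType} {d : measure_display} {Om : measurableType d}.
Variables (P : probability Om R) (omega : nat -> {RV P >-> bool}) (a : R).
Hypothesis coins : fair_coins P omega.
Hypothesis ha : 0 < a < 2^-1.

(* The Cantor measure itself, as the convolution with the Dirac mass at 0. *)
Local Notation mu := (convolution (cantor_measure P ha omega)
                      (scaled 0 (cantor_measure P ha omega))).

Let a01 := lt01_of ha.
Let a0 : 0 < a. Proof. by case/andP: ha. Qed.
Let sa := sdim_gt0 a01.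

Lemma cantor_dim_le : (hausdorff_dim (cantor_set a) <= (sdim a)%:E)%E.
Proof.
apply: (@hausdorff_dim_le R mu setT _ ((a / 2) `^ sdim a)) => //.
- by apply: (@le_lt_trans _ _ 1%E); [exact: probability_le1|exact: ltry].
- by rewrite powR_gt0 ?divr_gt0.
- move=> _ r [w _ <-] /andP[r0 r1]; split => //.
  have r2 : 0 < r / 2 <= 1 by lra.
  have [n /andP[nr rn]] := geometric_scale a01 r2.
  have xp : `|cantor_sum a w - pt a a 0 (mkseq w n.+1, [::])| <= trunc_err a a 0 n.+1 0.
    have /andP[h1 h2] := cantor_sum_itv w n.+1 a01.
    by rewrite /pt /trunc_err /= mul0r addr0 normr0 mul0r addr0 ger0_norm.
  have pin : (mkseq w n.+1, [::]) \in wpairs n.+1 0.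
    by rewrite mem_wpairs size_mkseq !eqxx.
  have er : 2 * trunc_err a a 0 n.+1 0 <= r.
    rewrite /trunc_err normr0 mul0r addr0; move: (a ^+ n.+1) nr => y; lra.
  apply: le_trans (conv_mass_ge coins ha ha r0 pin xp er).
  rewrite lee_fin expr0 mulr1 -(expn_sdim _ a01).
  rewrite -powRM ?divr_ge0 ?(ltW a0) ?(ltW r0)//.
  apply: ge0_ler_powR; rewrite ?nnegrE ?(ltW sa)//.
  + by apply: mulr_ge0; rewrite ?divr_ge0 ?(ltW a0) ?(ltW r0).
  + by rewrite exprn_ge0// ltW.
  + rewrite exprS -mulrA ler_pM2l//.
    by rewrite mulrC.
- exact: ltW.
Qed.

(** Here the second words are empty and [coll_cval_digits], taken with both bases equal to [a],
    bounds the collision sums directly. *)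
Lemma cantor_dim_ge : ((sdim a)%:E <= hausdorff_dim (cantor_set a))%E.
Proof.
have a2 : 0 < 1 - 2 * a by move: ha; lra.
(* The 3 comes from r + 2 a^n <= 3 a^n. *)
pose T := (Num.truncn (3 / (1 - 2 * a))).+1.
have T3 : 3 <= T%:R * (1 - 2 * a) by rewrite -ler_pdivrMr// ltW// truncnS_gt.
pose C := (2 * T + 1)%:R * (2 * (a `^ sdim a)^-1).
have corr r : 0 < r < 1 -> (correlation_integral mu r <= (C * r `^ sdim a)%:E)%E.
  move=> /andP[r0 r1].
  have [n /andP[nr rn]] := geometric_scale a01 (introT andP (conj r0 (ltW r1))).
  apply: (le_trans (correlation_le_pcoll 0 coins ha ha n 0 r0));
    rewrite lee_fin.
  apply: (@le_trans _ _ (coll (words n) (cval a) (T%:R * ((1 - 2 * a) * a ^+ n)))).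
    rewrite /pcoll /coll avg_allpairs; apply: le_avg => u _.
    rewrite avg_words0 avg_allpairs; apply: le_avg => v _.
    rewrite avg_words0 /pt /= !mul0r !addr0 ler_nat.
    case: (boolP (_ <= r + _)) => //= le; rewrite lt0b; apply: (le_trans le).
    rewrite /trunc_err normr0 mul0r addr0.
    apply: (@le_trans _ _ (3 * a ^+ n)).
      by move: (a ^+ n) rn => y; lra.
    by rewrite mulrA ler_wpM2r// exprn_ge0// ltW.
  apply: (le_trans (coll_cval_digits T ha a01 _)).
    rewrite /digits divff ?mulr1 ?natrK//.
    by rewrite lt_eqF// ln_lt0_of.
  rewrite /C -!mulrA ler_wpM2l// ler_wpM2l// ler_pdivlMl ?powR_gt0//.
  rewrite -powRM ?exprn_ge0 ?(ltW a0)//.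
  apply: ge0_ler_powR; rewrite ?nnegrE ?(ltW sa) ?(ltW r0)//.
    by rewrite mulr_ge0 ?exprn_ge0 ?(ltW a0).
  by rewrite -exprS ltW.
have full V : measurable V -> cantor_set a `<=` V -> mu V = 1%E.
  move=> mV CV; apply: conv_support => // w w'; rewrite mul0r addr0.
  by apply: CV; exists w.
by have [] := correlation_dim_ge ltr01 corr full.
Qed.

Lemma hausdorff_dim_cantor_set : hausdorff_dim (cantor_set a) = (sdim a)%:E.
Proof. by apply/eqP; rewrite eq_le cantor_dim_le cantor_dim_ge. Qed.

End CantorDimension.

(** * From power bounds to the correlation dimension *)

Section CorrelationLimit.
Context {R : realType}.
Variables (nu : probability R R) (D : R).

Lemma correlation_quotient_cvg :
  (exists2 c : R, 0 < c & forall r, 0 < r <= 1 ->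
    ((c * r `^ D)%:E <= correlation_integral nu r)%E) ->
  (forall e, 0 < e -> exists C r0 : R, [/\ 0 < C, 0 < r0 <= 1 &
    forall r, 0 < r < r0 ->
    (correlation_integral nu r <= (C * r `^ (D - e))%:E)%E]) ->
  correlation_quotient nu r @[r --> 0^'+] --> D.
Proof.
move=> [c c0 lower] upper; apply/cvgrPdist_le => e e0.
have e2 : 0 < e / 2 by rewrite divr_gt0.
have [C [r0 [C0 /andP[r00 r01] up]]] := upper _ e2.
(* For r < exp(-M), dividing by [ln r] leaves at most e of [ln c] and e/2 of [ln C]; the other e/2
   is the loss in the exponent of the upper bound. *)
pose M := Num.max (`|ln c| / e) (`|ln C| / (e / 2)) + 1.
have Mp : 0 < M by rewrite ltr_wpDl// le_max divr_ge0// ltW.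
near=> r.
have rp : 0 < r by near: r; exact: nbhs_right_gt.
have rr0 : r < r0 by near: r; exact: nbhs_right_lt.
have rM : r < expR (- M) by near: r; apply: nbhs_right_lt; exact: expR_gt0.
have lnr : ln r < - M by rewrite -ltr_expR lnK.
have lr0 : ln r < 0 by lra.
have Icap : 0 < r < r0 by rewrite rp.
have Icup : 0 < r <= 1 by rewrite rp/=; lra.
have I1 := lower r Icup; have I2 := up r Icap.
have fin : correlation_integral nu r \is a fin_num.
  rewrite ge0_fin_numE ?(le_lt_trans I2) ?ltry//.
  by apply: integral_ge0 => x _; exact: measure_ge0.
rewrite /correlation_quotient; move: I1 I2; rewrite -(fineK fin) !lee_fin.
set I := fine _ => I1 I2.
have rD t : 0 < r `^ t by rewrite powR_gt0.
have Ip : 0 < I by apply: lt_le_trans I1; rewrite mulr_gt0.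
have l1 : ln c + D * ln r <= ln I.
  by rewrite -ln_powR -lnM ?posrE// ler_ln ?posrE// mulr_gt0.
have l2 : ln I <= ln C + (D - e / 2) * ln r.
  by rewrite -ln_powR -lnM ?posrE// ler_ln ?posrE// mulr_gt0.
have cM : `|ln c| <= e * M.
  rewrite mulrC -ler_pdivrMr//;
    apply: (@le_trans _ _ (Num.max (`|ln c| / e) (`|ln C| / (e / 2)))).
    by rewrite le_max lexx.
  by rewrite /M lerDl.
have CM : `|ln C| <= e / 2 * M.
  rewrite mulrC -ler_pdivrMr//;
    apply: (@le_trans _ _ (Num.max (`|ln c| / e) (`|ln C| / (e / 2)))).
    by rewrite le_max lexx orbT.
  by rewrite /M lerDl.
have eM : e * M <= e * - ln r by rewrite ler_pM2l//; lra.
have nc := ler_norm (- ln c); have nC := ler_norm (ln C).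
rewrite normrN in nc.
rewrite ler_norml; apply/andP; split.
  rewrite lerBrDl -lerBrDr opprK ler_ndivrMr//; lra.
rewrite lerBlDr -lerBlDl ler_ndivlMr//; lra.
Unshelve. all: by end_near. Qed.

End CorrelationLimit.

Theorem mainTheorem2 (R : realType) (d : measure_display)
    (Om : measurableType d) (P : probability Om R)
    (omega : nat -> {RV P >-> bool}) (a b lambda : R)
    (hcoins : fair_coins P omega)
    (ha : 0 < a < 2^-1) (hb : 0 < b < 2^-1)
    (hirr : irrational (ln b / ln a)) (hlambda : lambda != 0) :
  let nu := convolution (cantor_measure P ha omega)
                        (scaled lambda (cantor_measure P hb omega)) in
  cvg (correlation_quotient nu r @[r --> 0^'+]) /\
  [/\ (correlation_dim nu)%:E = measure_hausdorff_dim nu,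
      measure_hausdorff_dim nu = measure_packing_dim nu &
      measure_packing_dim nu =
        Order.min (hausdorff_dim (cantor_set a) + hausdorff_dim (cantor_set b))%E
                  1%E].
Proof.
move=> nu; pose D := Num.min (sdim a + sdim b) 1.
have lim : correlation_quotient nu r @[r --> 0^'+] --> D.
  apply: correlation_quotient_cvg; first exact: correlation_ge.
  by move=> e; exact: correlation_le.
pose E0 := conv_attractor a b lambda.
have mE0 : measurable E0 by exact: measurable_conv_attractor.
have fE0 : nu (~` E0) = 0%E by exact: conv_attractor_full.
have [pE0 hE0] : (packing_dim E0 <= D%:E)%E /\ (hausdorff_dim E0 <= D%:E)%E.
  exact: (attractor_dim_le lambda hcoins ha hb).
have ge E : measurable E -> nu (~` E) = 0%E ->
    (D%:E <= hausdorff_dim E)%E /\ (D%:E <= packing_dim E)%E.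
  exact: conv_dim_ge.
have Hdim : measure_hausdorff_dim nu = D%:E.
  apply/eqP; rewrite eq_le; apply/andP; split.
    by apply: le_trans hE0; apply: ereal_inf_lbound; exists E0.
  by apply: le_ereal_inf_tmp => _ [E [mE /(ge E mE)[+ _]] <-].
have Pdim : measure_packing_dim nu = D%:E.
  apply/eqP; rewrite eq_le; apply/andP; split.
    by apply: le_trans pE0; apply: ereal_inf_lbound; exists E0.
  by apply: le_ereal_inf_tmp => _ [E [mE /(ge E mE)[_ +]] <-].
split; first by apply/cvg_ex; exists D.
split; rewrite ?Hdim ?Pdim//.
  by rewrite /correlation_dim; congr EFin; apply: cvg_lim.
rewrite (hausdorff_dim_cantor_set hcoins ha) (hausdorff_dim_cantor_set hcoins hb).
by rewrite /D EFin_min.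
Qed.
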